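(* Let $\mathcal{P}$ be the set of isomorphism classes of branched spines, and let $\mathcal{R}\subset\mathcal{P}$ be the subset of those spines to which no sliding branched MP-move (positive or negative) applies. (i) For every bicolorated (split into a black and a white part) closed surface $\Sigma$ there are at most two spines $P\in\mathcal{R}$ such that $\partial M(P)\cong\Sigma$ as bicolorated surfaces. (ii) If two elements of $\mathcal{P}\setminus\mathcal{R}$ are related through sliding branched MP-moves and snake moves, then they are also related through sliding branched MP-moves only.
   Context: Conventions. Manifolds are compact, oriented and 3-dimensional; homeomorphisms preserve orientation. A field is a nowhere-vanishing vector field. A field $v$ on $M$ is concave if it is simply tangent to $\partial M$ only along a finite union of circles, and near tangency points its orbits are contained in the interior of $M$; then $\partial M$ splits into a white part (where $v$ points inwards) and a black part (where $v$ points outwards). Branched spines. A quasi-standard polyhedron $P$ is a finite connected 2-dimensional polyhedron in which each point has a neighbourhood which is a disc, or three half-discs glued along their diameter, or the cone over the 1-skeleton of a tetrahedron (the cone point is then a vertex). $P$ is standard if all components of the natural stratification (vertices, edges, regions) are open cells. A screw-orientation of an edge is an orientation of the edge together with a cyclic order of the three incident germs of regions, up to simultaneous reversal; a screw-orientation of $P$ is a choice for each edge, compatible at vertices (each vertex neighbourhood embeds in $\mathbb{R}^3$ making all four screws right-handed). A branching is an orientation of each region such that no edge is induced the same orientation three times. A branched spine is a standard polyhedron with a screw-orientation and a branching. It determines, uniquely up to homeomorphism, a connected manifold $M(P)$ with non-empty boundary having $P\subset{\rm Int}\,M(P)$ as a spine, and a concave field $v(P)$ on $M(P)$ positively transversal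 to $P$: the branching makes $P$ a branched surface with an oriented tangent plane at each point (near each edge there is a locally two-sheeted side, containing the two regions inducing the same orientation on the edge, and a locally one-sheeted side), $M(P)$ is a regular neighbourhood of $P$, and the orbits of $v(P)$ are the segments normal to $P$. $\partial M(P)$ is bicolorated by the black-white splitting given by $v(P)$. Sliding branched MP-moves. Let $\mathcal{T}(P)$ be the triangulation of $M(P)/\partial M(P)$ (self- and multiple adjacencies allowed) with only vertex the image of $\partial M(P)$ and edges, triangles, tetrahedra dual to the regions, edges, vertices of $P$. Branchings of $P$ correspond to orientations of the edges of $\mathcal{T}(P)$ (chosen to intersect the dual regions positively) for which no triangle is cyclically oriented. A positive branched MP-move replaces two distinct tetrahedra sharing a triangle, with opposite apexes $a,c$, by three tetrahedra around a new edge $ac$, all other edges keeping their orientation and $ac$ being oriented so that no triangle is cyclically oriented. The five abstract vertices of the bipyramid are then totally ordered ($x<y$ if the edge goes from $x$ to $y$). The move is sliding if it does not locally modify the black-white splitting of the boundary in an essential way; equivalently, if $\{a,c\}$ is neither the pair of the two smallest nor that of the two largest vertices. Negative moves are the inverses of positive ones. Snake move (and its inverse): a branched 0-to-2 move (creating two vertices), performed near an interior point of an edge $e$ of $P$ and realized through branched polyhedra positively transversal to $v(P)$: $e$ is bent inside a small disc so that two strands of it face each other across the locally one-sheeted side, and then one of the two strands is pushed (extending the locally two-sheeted area across the one-sheeted one) past the other strand, either above or below (with respect to the direction of the field) the sheets met there. *)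

(* Defs.v *)
From HB Require Import structures.
From Stdlib Require Export Relation_Operators.
From mathcomp Require Export all_boot all_order all_algebra all_fingroup.
From mathcomp Require Export all_classical all_reals all_analysis.
Export numFieldNormedType.Exports.

Set Implicit Arguments.
Unset Strict Implicit.
Unset Printing Implicit Defensive.

Import Order.TTheory GRing.Theory Num.Theory.
Local Open Scope classical_set_scope.
Local Open Scope ring_scope.

(* A branched spine P is encoded by its dual triangulation T(P).

   - Each vertex of P is dual to a tetrahedron, whose vertices are labelled by
     'I_4 in an arbitrary way.  A neighbourhood of the vertex of P is the cone
     over the 1-skeleton of the dual tetrahedron: the faces of t (indexed by the
     opposite vertex) are the germs of edges, its edges the germs of regions.
   - Each edge of P matches two germs of edges and the three germs of regions
     at each of them.  Dually, [glue t i = (t', s)] says that the face of t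
     opposite to i is identified with the face of t' opposite to s i, a vertex
     j != i of the former being sent to s j.  A standard polyhedron has open
     cells as strata, so it is nonempty, and it is determined by these data.
   - A screw-orientation is an orientation of the dual pseudomanifold: [sgn t]
     tells whether the labelling 0, 1, 2, 3 of t is positive, and the gluings
     reverse the orientations induced on the faces.
   - A branching orients the regions of P, equivalently the dual edges:
     [arr t i j] means that the edge of t joining i and j points from i to j.
     An edge of P is induced the same orientation by its three incident regions
     exactly when the dual triangle is cyclically oriented.

   Isomorphisms ([spine_iso] below) may change the labellings. *)
Record spine := Spine {
  tet : finType;
  sgn : tet -> bool;
  glue : tet -> 'I_4 -> tet * 'S_4;
  arr : tet -> rel 'I_4;
  spine_nonempty : (0 < #|tet|)%N;
  glue_invol : forall t i, let: (t', s) := glue t i in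
    glue t' (s i) = (t, s^-1%g);
  glue_no_fix : forall t i, let: (t', s) := glue t i in
    (t', s i) <> (t, i);
  glue_orient : forall t i, let: (t', s) := glue t i in
    sgn t (+) sgn t' (+) odd_perm s;
  spine_connected : forall t u,
    connect (fun a b => [exists i, (glue a i).1 == b]) t u;
  arr_tournament : forall t i j, arr t i j = (i != j) && ~~ arr t j i;
  arr_acyclic : forall t i j k, ~ [/\ arr t i j, arr t j k & arr t k i];
  arr_glue : forall t i j k, j != i -> k != i ->
    let: (t', s) := glue t i in arr t' (s j) (s k) = arr t j k
}.

Definition spine_iso (P Q : spine) : Prop :=
  exists (f : tet P -> tet Q) (p : tet P -> 'S_4),
    [/\ bijective f,
        forall t, sgn (f t) = sgn t (+) odd_perm (p t),
        forall t i j, arr (f t) (p t i) (p t j) = arr t i j &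
        forall t i, let: (t', s) := glue t i in
          glue (f t) (p t i) = (f t', ((p t)^-1 * s * p t')%g)].

(* Since no triangle is cyclic, the edges of a tetrahedron totally order its
   vertices, and every spine is isomorphic to one in which this order is that
   of the labels.  The moves are described on such spines; all gluings then
   preserve the order of the vertices, so they are determined by [pairing]. *)
Definition ordered (P : spine) : Prop :=
  forall (t : tet P) (i j : 'I_4), arr t i j = (i < j)%N.

Definition face (P : spine) : Type := (tet P * 'I_4)%type.

Definition pairing (P : spine) (x : face P) : face P :=
  ((glue x.1 x.2).1, (glue x.1 x.2).2 x.2).

Definition up_to_iso (m : spine -> spine -> Prop) (P Q : spine) : Prop :=
  exists P0 Q0 : spine,
    [/\ spine_iso P P0, ordered P0, m P0 Q0, ordered Q0 & spine_iso Q0 Q].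

(* The bipyramid has vertices 'I_5, labelled according to their total order,
   and apexes a, c with A = {a, c}.  For each vertex k let D_k be the
   tetrahedron with vertices 'I_5 minus k, labelled by [lift k].  Then P
   contains D_a and D_c, which share the triangle opposite to the apexes, while
   Q contains the D_k for k outside A, which share the edge ac.
   [opposite k l] is the label in D_k of the vertex l != k; it also denotes the
   face D_k inter D_l of D_k. *)
Definition opposite (k l : 'I_5) : 'I_4 := odflt ord0 (unlift k l).

Section MPMove.
Variables (A : {set 'I_5}) (P Q : spine) (E : finType).
Variables (h : E + {k : 'I_5 | k \in A} -> tet P).
Variables (h' : E + {k : 'I_5 | k \notin A} -> tet Q).

(* Faces of P and of Q that are the same before and after the move: those of
   the tetrahedra in E not involved in the move, and the six triangles
   D_k inter D_l, with k in A and l outside A, bounding the bipyramid. *)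
Definition same_face (x : face P) (x' : face Q) : Prop :=
  (exists e i, x = (h (inl e), i) /\ x' = (h' (inl e), i)) \/
  (exists k l, x = (h (inr k), opposite (val k) (val l)) /\
               x' = (h' (inr l), opposite (val l) (val k))).

(* D_k is induced the orientation (-1)^k by the boundary of the 4-simplex;
   the two sides of the move have opposite orientations there. *)
Definition mp_replacement (eps : bool) : Prop :=
  [/\ bijective h /\ bijective h',
      (forall e, sgn (h' (inl e)) = sgn (h (inl e))) /\
      (forall k, sgn (h (inr k)) = eps (+) odd (val k)) /\
      (forall k, sgn (h' (inr k)) = ~~ eps (+) odd (val k)),
      (forall k l, val k != val l ->
         pairing (h (inr k), opposite (val k) (val l)) =
           (h (inr l), opposite (val l) (val k))),
      (forall k l, val k != val l ->
         pairing (h' (inr k), opposite (val k) (val l)) =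
           (h' (inr l), opposite (val l) (val k))) &
      (forall x x' y y', same_face x x' -> same_face y y' ->
         pairing x = y <-> pairing x' = y')].

End MPMove.

Definition mp_move_at (A : {set 'I_5}) (P Q : spine) : Prop :=
  exists (E : finType) (h : E + {k : 'I_5 | k \in A} -> tet P)
    (h' : E + {k : 'I_5 | k \notin A} -> tet Q) (eps : bool),
    mp_replacement h h' eps.

Definition positive_sliding_move : spine -> spine -> Prop :=
  up_to_iso (fun P Q => exists A : {set 'I_5},
    [/\ #|A| = 2%N,
        A != [set k : 'I_5 | (k < 2)%N]%SET,
        A != [set k : 'I_5 | (2 < k)%N]%SET &
        mp_move_at A P Q]).

(* The spines to which no sliding move applies, positive or negative. *)
Definition rigid (P : spine) : Prop :=
  forall Q, ~ positive_sliding_move P Q /\ ~ positive_sliding_move Q P.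

(* The snake move on the edge e of P dual to the triangle [x] = [pairing x].

   Let a vertex of a branched surface have, in its locally 3-sheeted quadrant,
   the sheets A, B, C from top to bottom.  The dual vertices 0 < 1 < 2 < 3 are
   the regions of space below C, between B and C, between A and B, above A.
   The branch line along which A and B merge goes through the faces 0 (on the
   3-sheeted side) and 1; the line along which B and C merge goes through the
   faces 3 (on the 3-sheeted side) and 2.

   After the bending and the pushing, e crosses itself at two vertices p and q,
   met in the order p, q, q, p: the two strands bound a 3-sheeted bigon with
   vertices p and q, merging A, B along one strand and B, C along the other,
   and the arc from q to q bounds a one-sheeted disc.  The strand merging A, B
   passes through the face 1 of p, its face 0, the face 0 of q and its face 1;
   the other one through the face 2 of q, its face 3, the face 3 of p and its
   face 2; the arc at q joins its faces 1 and 2.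
   Hence p and q form a block with outer faces 1 and 2 of p.  Which of the two
   germs of e is [x] corresponds to pushing above or below; pushing one strand
   above the other is the same as pushing the latter below the former. *)
Definition snake_at (P Q : spine) : Prop :=
  exists (h : tet P + bool -> tet Q) (x y : face P),
    let emb (z : face P) : face Q := (h (inl z.1), z.2) in
    let p (i : nat) : face Q := (h (inr true), inord i) in
    let q (i : nat) : face Q := (h (inr false), inord i) in
    [/\ bijective h,
        forall t, sgn (h (inl t)) = sgn t,
        pairing x = y,
        forall z, z <> x -> z <> y -> pairing (emb z) = emb (pairing z) &
        [/\ pairing (emb x) = p 1%N, pairing (emb y) = p 2%N,
            pairing (p 0%N) = q 0%N, pairing (p 3%N) = q 3%N &
            pairing (q 1%N) = q 2%N]].

Definition snake_move : spine -> spine -> Prop := up_to_iso snake_at.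

Definition related (m : spine -> spine -> Prop) : spine -> spine -> Prop :=
  clos_refl_sym_trans spine (fun P Q => spine_iso P Q \/ m P Q).

Definition homeo_on (X Y : topologicalType) (A : set X) (B : set Y)
    (f : X -> Y) : Prop :=
  exists g : Y -> X,
    [/\ {within A, continuous f}, {within B, continuous g},
        forall x, A x -> B (f x) /\ g (f x) = x &
        forall y, B y -> A (g y) /\ f (g y) = y].

Record bicolored_space := BicoloredSpace {
  underlying :> topologicalType;
  white : set underlying;
  black : set underlying
}.

Definition bicolored_homeo (S S' : bicolored_space) : Prop :=
  exists f : S -> S', [/\ homeo_on [set: S] [set: S'] f,
    f @` @white S = @white S' & f @` @black S = @black S'].

(* A closed surface, not necessarily connected, cut into two subsurfaces along
   their common boundary, which is a finite union of circles by compactness. *)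
Definition closed_bicolored_surface (R : realType) (S : bicolored_space)
    : Prop :=
  [/\ compact [set: S], hausdorff_space S &
      forall a : S, exists (U : set S) (V : set (R * R)%type)
          (f : S -> (R * R)%type),
        [/\ open U, U a, open V, homeo_on U V f &
            [\/ forall b, U b -> @white S b /\ ~ @black S b,
                forall b, U b -> @black S b /\ ~ @white S b |
                forall b, U b -> (@white S b <-> 0 <= (f b).1) /\
                                 (@black S b <-> (f b).1 <= 0)]]].

(* M(P) is obtained from T(P) by removing an open neighbourhood of the
   vertices, so its boundary is tiled by the links of the vertices v of the
   tetrahedra t; such a link is a triangle whose corners are the vertices of t
   other than v, with barycentric coordinates x. *)
Definition link_triangle (R : realType) (v : 'I_4) : set 'rV[R]_4 :=
  [set x : 'rV[R]_4 |
    [/\ x ord0 v = 0, forall i, 0 <= x ord0 i & \sum_i x ord0 i = 1]].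

Section Boundary.
Variables (R : realType) (P : spine).

Definition link_point : topologicalType :=
  {c : (tet P * 'I_4)%type & set_type (@link_triangle R c.2)}.

Definition tet_of (a : link_point) : tet P := (projT1 a).1.
Definition vertex_of (a : link_point) : 'I_4 := (projT1 a).2.
Definition coord (a : link_point) (i : 'I_4) : R :=
  set_val (projT2 a) ord0 i.

Definition glued (a b : link_point) : Prop :=
  exists i, i <> vertex_of a /\ coord a i = 0 /\
    let: (t', s) := glue (tet_of a) i in
    [/\ tet_of b = t', vertex_of b = s (vertex_of a) &
        forall j, coord b (s j) = coord a j].

Definition glued_closure (a b : link_point) : bool :=
  `[< clos_refl_sym_trans link_point glued a b >].

Lemma glued_closure_equiv : equiv_class_of glued_closure.
Proof.
split=> [a|a b|b a c].
- by apply/asboolP; exact: rst_refl.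
- by apply/asboolP/asboolP => ab; exact: rst_sym.
- by move=> /asboolP ab /asboolP bc; apply/asboolP; exact: rst_trans ab bc.
Qed.

Canonical glued_closure_equiv_rel := EquivRelPack glued_closure_equiv.

Definition boundary_carrier : topologicalType :=
  quotient_topology {eq_quot glued_closure}%qT.

Definition boundary_pi (a : link_point) : boundary_carrier :=
  (\pi_({eq_quot glued_closure}%qT) a)%qT.

(* The orbits of v(P) follow the edges of T(P).  Near the corner w of the link
   of v, the field thus points into M(P) if the edge goes from v to w and out
   of it otherwise; in each triangle a normal arc separates the corners of the
   first type from those of the second. *)
Definition out_weight (a : link_point) : R :=
  \sum_(w | arr (tet_of a) (vertex_of a) w) coord a w.

Definition boundary : bicolored_space :=
  @BicoloredSpace boundary_carrier
    (boundary_pi @` [set a | 2^-1 <= out_weight a])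
    (boundary_pi @` [set a | out_weight a <= 2^-1]).

End Boundary.

(* Main.v *)
(* (ii) A snake move always produces a spine admitting a sliding move, so it
   suffices to show that all snakes on a given spine are related by sliding
   moves, and that a spine admitting a sliding move is related to one of its
   snakes.  Both facts are local: the eight snakes on the two germs at the four
   faces of a tetrahedron are related by explicit sequences of sliding moves
   performed inside the tetrahedron and the snake, whence a snake can travel
   everywhere because spines are connected; and for each of the eight possible
   gluings of two distinct tetrahedra allowing a positive sliding move, an
   explicit sequence of sliding moves starting there creates a snake.

   (i) No positive sliding move applies exactly when two distinct tetrahedra are
   only glued along faces with the same label 0 or 3.  The faces 1 and 2 of each
   tetrahedron are then glued inside it, which leaves a single tetrahedron, with
   gluings 0-3, 1-2 or 0-1, 2-3, and the cycles of 2n tetrahedra with gluings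
   1-2 inside each and 0-0, 3-3 alternately.  The boundary has respectively 1, 2
   and 2n + 1 components; in the first two cases the spine is determined by the
   sign of its tetrahedron, in the last one by n. *)

From mathcomp Require Import zify lra.
Require Import Defs.

Set Implicit Arguments.
Unset Strict Implicit.
Unset Printing Implicit Defensive.

(** * Ordered spines as face pairings *)

(** The chain of moves in (ii) may cross rigid spines, where no sliding move starts. It is therefore
    followed through a snake placed on each of its spines, since a snake always leaves a gluing
    where a sliding move starts. Sequences of moves are checked by computation on patches and hold
    whatever surrounds the patch: the context may glue free faces of the patch to each other, so
    tetrahedra glued to themselves need no separate treatment. One mirror image of each patch is
    enough, a boolean supplying the other. On ordered spines an increasing relabelling is the
    identity, so that a spine reduces to a sign-changing involution of faces, and an isomorphism to
    a bijection of tetrahedra. In (i) the number of boundary components separates the three families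
    and counts the tetrahedra of a necklace. The bound two comes from the two signs of a single
    tetrahedron, whereas a necklace contains tetrahedra of both signs and is isomorphic to its
    mirror image. *)

Lemma ord_increasing_id n (r : 'I_n -> 'I_n) :
  (forall a b : 'I_n, a < b -> r a < r b)%N -> forall a : 'I_n, r a = a.
Proof.
have ge_id (r' : 'I_n -> 'I_n) :
    (forall a b : 'I_n, a < b -> r' a < r' b)%N ->
    forall a : 'I_n, (a <= r' a)%N.
  move=> r'M [a lt_an]; elim: a lt_an => // a IHa lt_an.
  apply: leq_ltn_trans (IHa (ltnW lt_an)) _.
  exact: (r'M (Ordinal (ltnW lt_an)) (Ordinal lt_an)).
move=> rM a; apply/val_inj/eqP; rewrite eqn_leq (ge_id r rM a) andbT.
(* Conjugation by [rev_ord] keeps [r] increasing and turns the lower bound into the upper one. *)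
have r'M (b c : 'I_n) : (b < c)%N ->
    (rev_ord (r (rev_ord b)) < rev_ord (r (rev_ord c)))%N.
  move=> lt_bc.
  have := rM (rev_ord c) (rev_ord b); have := ltn_ord (r (rev_ord b)).
  have := ltn_ord c; have := ltn_ord (r (rev_ord c)); move=> /=; lia.
have := ge_id _ r'M (rev_ord a); rewrite rev_ordK /=.
have := ltn_ord a; have := ltn_ord (r a); lia.
Qed.

Lemma glue_invol1 (P : spine) (t : tet P) (i : 'I_4) :
  glue (glue t i).1 ((glue t i).2 i) = (t, ((glue t i).2)^-1%g).
Proof. by have := glue_invol t i; case: (glue t i). Qed.

Lemma spine_isoP (P Q : spine) : spine_iso P Q <->
  exists (f : tet P -> tet Q) (p : tet P -> 'S_4),
    [/\ bijective f,
        forall t, sgn (f t) = sgn t (+) odd_perm (p t),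
        forall t i j, arr (f t) (p t i) (p t j) = arr t i j &
        forall t i, glue (f t) (p t i) =
          (f (glue t i).1, ((p t)^-1 * (glue t i).2 * p (glue t i).1)%g)].
Proof.
split=> -[f [p [fB sP aP gP]]]; exists f, p; split=> // t i;
  by have := gP t i; case: (glue t i).
Qed.

Lemma spine_iso_refl (P : spine) : spine_iso P P.
Proof.
apply/spine_isoP; exists id, (fun=> 1%g); split=> [|t|t i j|t i].
- by exists id.
- by rewrite odd_perm1 addbF.
- by rewrite !perm1.
- by rewrite perm1 invg1 mul1g mulg1; case: (glue t i).
Qed.

Lemma spine_iso_sym (P Q : spine) : spine_iso P Q -> spine_iso Q P.
Proof.
case/spine_isoP=> f [p [[g fK gK] sP aP gP]].
apply/spine_isoP; exists g, (fun u => (p (g u))^-1%g); split=> [|u|u i j|u i].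
- by exists f.
- by rewrite odd_permV -{2}[u]gK sP addbK.
- by rewrite -[in RHS](gK u) -[i in RHS](permKV (p (g u)))
             -[j in RHS](permKV (p (g u))) aP.
- have := gP (g u) ((p (g u))^-1%g i); rewrite permKV gK => -> /=.
  by rewrite !fK invgK !mulgA mulgV mul1g -mulgA mulgV mulg1; case: (glue _ _).
Qed.

Lemma spine_iso_trans (P Q S : spine) :
  spine_iso P Q -> spine_iso Q S -> spine_iso P S.
Proof.
case/spine_isoP=> f [p [fB sP aP gP]] /spine_isoP[f' [p' [fB' sP' aP' gP']]].
apply/spine_isoP; exists (f' \o f), (fun t => p t * p' (f t))%g.
split=> [|t|t i j|t i] /=.
- exact: bij_comp.
- by rewrite sP' sP odd_permM addbA.
- by rewrite !permM aP' aP.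
- by rewrite permM gP' gP /= invMg !mulgA.
Qed.

(** Read through [lift] on both sides, the gluing is an increasing self-map of ['I_3], hence
    trivial. The pairing of faces thus determines all gluings. *)
Lemma ordered_glue (P : spine) : ordered P -> forall (t : tet P) i,
  (glue t i).2 = lift_perm i ((glue t i).2 i) 1%g.
Proof.
move=> oP t i; set s := (glue t i).2; apply/permP => j.
case: (unliftP i j) => [{}j|] ->; last by rewrite lift_perm_id.
rewrite lift_perm_lift perm1.
pose r (a : 'I_3) := odflt ord0 (unlift (s i) (s (lift i a))).
have rE a : s (lift i a) = lift (s i) (r a).
  have /unlift_some[b bE bE'] : s i != s (lift i a).
    by rewrite (inj_eq perm_inj) neq_lift.
  by rewrite /r bE' /= bE.
rewrite rE (@ord_increasing_id _ r) // => a b lt_ab.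
have := arr_glue t (i := i) (j := lift i a) (k := lift i b).
rewrite ![lift i _ == i]eq_sym !(negPf (neq_lift _ _)).
move: (rE a) (rE b); rewrite /s; case: (glue t i) => u s' /= rEa rEb.
move/(_ isT isT); rewrite !oP rEa rEb /=.
by rewrite !ltnNge !leq_bump2 -!ltnNge => ->.
Qed.

Lemma ordered_iso (P Q : spine) (f : tet P -> tet Q) :
    ordered P -> ordered Q -> bijective f ->
    (forall t, sgn (f t) = sgn t) ->
    (forall x, pairing (f x.1, x.2) = (f (pairing x).1, (pairing x).2)) ->
  spine_iso P Q.
Proof.
move=> oP oQ fB fS fP; apply/spine_isoP; exists f, (fun=> 1%g).
split=> // [t|t i j|t i].
- by rewrite odd_perm1 addbF.
- by rewrite !perm1 oP oQ.
rewrite perm1 invg1 mul1g mulg1; have [fP1 fP2] := fP (t, i).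
by rewrite [LHS]surjective_pairing fP1 ordered_glue // fP2 -ordered_glue.
Qed.

(** Both arrow relations are the order of the labels, so each relabelling [p t] is increasing and
    therefore trivial. *)
Lemma iso_ordered (P Q : spine) :
    ordered P -> ordered Q -> spine_iso P Q ->
  exists f : tet P -> tet Q, [/\ bijective f,
    forall t, sgn (f t) = sgn t &
    forall x, pairing (f x.1, x.2) = (f (pairing x).1, (pairing x).2)].
Proof.
move=> oP oQ /spine_isoP[f [p [fB sP aP gP]]].
have p1 t : p t = 1%g.
  apply/permP => i; rewrite perm1; apply: ord_increasing_id => a b lt_ab.
  by rewrite -(oQ (f t)) aP oP.
exists f; split=> // [t|[t i]]; first by rewrite sP p1 odd_perm1 addbF.
rewrite /pairing /=.
by have := gP t i; rewrite !p1 perm1 invg1 mul1g mulg1 => ->.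
Qed.

Section Gluing.

(** The orientation induced on the face opposite to vertex [i], with the usual boundary sign
    [(-1)^i]. *)
Definition face_sgn (T : Type) (sg : T -> bool) (x : T * 'I_4) : bool :=
  sg x.1 (+) odd x.2.

(** The data that an ordered spine retains. That no face is glued to itself follows from
    [gluing_sgn]. Connectedness is expressed by invariant boolean functions, a form that passes
    easily to a spine assembled from a patch and a context. *)
Record gluing (T : finType) (sg : T -> bool) (pr : T * 'I_4 -> T * 'I_4) :
    Prop := Gluing {
  gluing_nonempty : (0 < #|T|)%N;
  gluing_invol : involutive pr;
  gluing_sgn : forall x, face_sgn sg (pr x) = ~~ face_sgn sg x;
  gluing_connected : forall g : T -> bool,
    (forall x, g (pr x).1 = g x.1) -> forall t u, g t = g u
}.

Variables (T : finType) (sg : T -> bool) (pr : T * 'I_4 -> T * 'I_4).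
Hypothesis H : gluing sg pr.

Let gl t i := ((pr (t, i)).1, lift_perm i (pr (t, i)).2 1%g).

Fact gluing_spine_invol t i : let: (t', s) := gl t i in
  gl t' (s i) = (t, s^-1%g).
Proof.
rewrite /gl lift_perm_id -surjective_pairing (gluing_invol H) /=.
by rewrite lift_permV invg1.
Qed.

Fact gluing_spine_no_fix t i : let: (t', s) := gl t i in (t', s i) <> (t, i).
Proof.
rewrite /gl lift_perm_id -surjective_pairing => prE.
by have := gluing_sgn H (t, i); rewrite prE; case: face_sgn.
Qed.

Fact gluing_spine_orient t i : let: (t', s) := gl t i in
  sg t (+) sg t' (+) odd_perm s.
Proof.
rewrite /gl odd_lift_perm odd_perm1 addbF.
have := gluing_sgn H (t, i); rewrite /face_sgn /=.
by move: (sg t) (sg _) (odd i) (odd _) => [] [] [] [].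
Qed.

Fact gluing_spine_connected t u :
  connect (fun a b => [exists i, (gl a i).1 == b]) t u.
Proof.
pose e : rel T := fun a b => [exists i, (gl a i).1 == b].
have e_sym a b : e a b -> e b a.
  case/existsP=> i /eqP <-; apply/existsP; exists (pr (a, i)).2.
  by rewrite /gl -surjective_pairing (gluing_invol H).
rewrite -/e -(gluing_connected H (g := connect e t) _ t u) ?connect0 // => x.
have ex : e x.1 (pr x).1.
  by apply/existsP; exists x.2; rewrite /gl -surjective_pairing.
apply/idP/idP => c_t; apply: connect_trans c_t (connect1 _) => //.
exact: e_sym.
Qed.

Fact gluing_spine_tournament (t : T) (i j : 'I_4) :
  (i < j)%N = (i != j) && ~~ (j < i)%N.
Proof. by rewrite -leqNgt ltn_neqAle. Qed.

Fact gluing_spine_acyclic (t : T) (i j k : 'I_4) :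
  ~ [/\ (i < j)%N, (j < k)%N & (k < i)%N].
Proof. by case=> ij jk ki; have := ltn_trans (ltn_trans ij jk) ki; rewrite ltnn. Qed.

Fact gluing_spine_arr t (i j k : 'I_4) : j != i -> k != i ->
  let: (t', s) := gl t i in (s j < s k)%N = (j < k)%N.
Proof.
rewrite ![_ == i]eq_sym /gl => /unlift_some[{}j -> _] /unlift_some[{}k -> _].
by rewrite !lift_perm_lift !perm1 /= !ltnNge !leq_bump2.
Qed.

Definition gluing_spine : spine :=
  @Spine T sg gl (fun _ i j => i < j)%N (gluing_nonempty H)
    gluing_spine_invol gluing_spine_no_fix gluing_spine_orient
    gluing_spine_connected gluing_spine_tournament gluing_spine_acyclic
    gluing_spine_arr.

Lemma gluing_spine_pairing (x : face gluing_spine) : pairing x = pr x.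
Proof. by rewrite /pairing /= lift_perm_id -!surjective_pairing. Qed.

End Gluing.

Lemma pairingK (P : spine) : involutive (@pairing P).
Proof.
by move=> [t i]; rewrite /pairing /= glue_invol1 /= permK.
Qed.

Lemma ordered_gluing (P : spine) : ordered P -> gluing (@sgn P) (@pairing P).
Proof.
move=> oP; split; first exact: spine_nonempty; first exact: pairingK.
- move=> [t i]; rewrite /pairing /face_sgn /=.
  have := glue_orient t i; have := ordered_glue oP t i.
  case: (glue t i) => u s /= sE; rewrite sE odd_lift_perm odd_perm1 addbF lift_perm_id.
  by move: (sgn t) (sgn u) (odd i) (odd (s i)) => [] [] [] [].
- move=> g gP t u; have /connectP[q] := spine_connected t u.
  elim: q t => [|v q IHq] t /=; first by move=> _ ->.
  case/andP=> /existsP[i /eqP <-] qP uE; rewrite -(IHq _ qP uE).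
  by rewrite -(gP (t, i)).
Qed.

(** An acyclic tournament is a total order, in which the number of predecessors is the rank.
    Relabelling by rank changes the sign of a tetrahedron by the parity of the relabelling. *)
Lemma ordered_spine (P : spine) : exists P0, spine_iso P P0 /\ ordered P0.
Proof.
have arrN (t : tet P) i : arr t i i = false by rewrite arr_tournament eqxx.
have arrT (t : tet P) i j k : arr t i j -> arr t j k -> arr t i k.
  move=> ij jk; rewrite arr_tournament; apply/andP; split.
    apply: contraTneq jk => <-; move: ij; rewrite arr_tournament.
    by case/andP.
  by apply/negP => ki; case: (@arr_acyclic P t i j k).
pose r t i := #|[pred j | @arr P t j i]|.
have r_lt t i : (r t i < 4)%N.
  rewrite -[X in (_ < X)%N]card_ord; apply: proper_card.
  apply/properP; split; first by apply/fintype.subsetP => j; rewrite inE.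
  by exists i; rewrite !inE // arrN.
have rM t i j : arr t i j -> (r t i < r t j)%N.
  move=> ij; apply: proper_card; apply/properP; split.
    by apply/fintype.subsetP => k; rewrite !inE => ki; apply: arrT ki ij.
  by exists i; rewrite !inE // arrN.
have rE t i j : (r t i < r t j)%N = arr t i j.
  apply/idP/idP => [|/rM //]; apply: contraLR => nij; rewrite -leqNgt.
  have [<- //|ne_ij] := eqVneq i j.
  by apply/ltnW/rM; rewrite arr_tournament eq_sym ne_ij.
have r_inj t : injective (fun i => Ordinal (r_lt t i)).
  move=> i j [] rij; apply/eqP/negPn/negP => ne_ij.
  have := arr_tournament t i j; rewrite -!rE rij ltnn ne_ij.
  by [].
pose p t := perm (@r_inj t).
have pE t i j : (p t i < p t j)%N = arr t i j by rewrite !permE /= rE.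
pose gl t i := let u := glue t ((p t)^-1%g i) in
  (u.1, ((p t)^-1 * u.2 * p u.1)%g).
have glE t i : gl t (p t i) =
    ((glue t i).1, ((p t)^-1 * (glue t i).2 * p (glue t i).1)%g).
  by rewrite /gl permK.
have glI t i : let: (t', s) := gl t i in gl t' (s i) = (t, s^-1%g).
  rewrite /gl !permM permK; set j := (p t)^-1%g i.
  by rewrite glue_invol1 /= !invMg invgK mulgA.
have glN t i : let: (t', s) := gl t i in (t', s i) <> (t, i).
  rewrite /gl !permM; have := glue_no_fix t ((p t)^-1%g i).
  case: (glue _ _) => u s /= nE [uE]; rewrite uE in nE *.
  move=> /(canRL (permK (p t))) sE; apply: nE.
  by rewrite sE.
have glO t i : let: (t', s) := gl t i in
    (sgn t (+) odd_perm (p t)) (+) (sgn t' (+) odd_perm (p t')) (+) odd_perm s.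
  rewrite /gl; have := glue_orient t ((p t)^-1%g i).
  case: (glue _ _) => u s /=; rewrite !odd_permM odd_permV.
  move: (sgn t) (sgn u) (odd_perm (p t)) (odd_perm s) (odd_perm (p u)).
  by move=> [] [] [] [] [].
have glC t u : connect (fun a b => [exists i, (gl a i).1 == b]) t u.
  apply: connect_sub (spine_connected t u) => a b /existsP[i /eqP <-].
  by apply: connect1; apply/existsP; exists (p a i); rewrite glE.
have glA t (i j k : 'I_4) : j != i -> k != i ->
    let: (t', s) := gl t i in (s j < s k)%N = (j < k)%N.
  rewrite /gl -(inj_eq (@perm_inj _ (p t)^-1%g)) => ji.
  rewrite -(inj_eq (@perm_inj _ (p t)^-1%g)) => ki.
  have := arr_glue t ji ki; case: (glue _ _) => u s /= aE.
  by rewrite !permM pE aE -pE !permKV.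
pose P0 := @Spine (tet P) (fun t => sgn t (+) odd_perm (p t)) gl
  (fun _ i j => i < j)%N (spine_nonempty P) glI glN glO glC
  (@gluing_spine_tournament (tet P)) (@gluing_spine_acyclic (tet P)) glA.
exists P0; split=> //; apply/spine_isoP; exists id, p; split=> //=.
by exists id.
Qed.

(** * Patches and their contexts *)

Section Patch.

Variables (O : Type) (os : O -> bool).

(* A patch is a set of tetrahedra some of whose faces are matched with each
   other, the remaining ones being in bijection with the labels [O] through
   [att].  A context is what is left of a spine when a patch is removed: it
   matches its faces and the labels, a label standing for the face attached to
   it, and two labels may be matched with each other.  Since [os] prescribes the
   signs of the faces attached to the labels, a context can be closed with any
   patch having the same labels, and moves in a patch are moves of the spine. *)
Record patch := Patch {
  ptet : finType;
  psgn : ptet -> bool;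
  att : O -> ptet * 'I_4;
  pmatch : ptet * 'I_4 -> ptet * 'I_4 + O;
  patch_nonempty : (0 < #|ptet|)%N;
  att_sgn : forall o, face_sgn psgn (att o) = os o;
  pmatch_att : forall o, pmatch (att o) = inr o;
  att_pmatch : forall x o, pmatch x = inr o -> att o = x;
  pmatch_invol : forall x y, pmatch x = inl y -> pmatch y = inl x;
  pmatch_sgn : forall x y, pmatch x = inl y ->
    face_sgn psgn y = ~~ face_sgn psgn x;
  patch_connected : forall g : ptet -> bool,
    (forall x y, pmatch x = inl y -> g y.1 = g x.1) -> forall t u, g t = g u
}.

Definition end_val (T : Type) (g : T * 'I_4 -> bool) (g' : O -> bool)
    (z : T * 'I_4 + O) : bool :=
  match z with inl x => g x | inr o => g' o end.

Record context := Context {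
  ctet : finType;
  csgn : ctet -> bool;
  cmatch : ctet * 'I_4 + O -> ctet * 'I_4 + O;
  cmatchK : involutive cmatch;
  cmatch_sgn : forall z,
    end_val (face_sgn csgn) os (cmatch z) = ~~ end_val (face_sgn csgn) os z;
  context_connected : forall (g : ctet -> bool) (b : bool),
    (forall z, end_val (g \o fst) (fun=> b) (cmatch z) =
               end_val (g \o fst) (fun=> b) z) ->
    forall e, g e = b
}.

Section Close.

Variables (C : context) (L : patch).

Let T : finType := (ctet C + ptet L)%type.

Definition close_sgn (t : T) : bool :=
  match t with inl e => csgn e | inr u => psgn u end.

Definition infc (x : ptet L * 'I_4) : T * 'I_4 := (inr x.1, x.2).

Definition out (z : ctet C * 'I_4 + O) : T * 'I_4 :=
  match z with inl x => (inl x.1, x.2) | inr o => infc (att L o) end.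

Definition close_match (x : T * 'I_4) : T * 'I_4 :=
  match x.1 with
  | inl e => out (cmatch (inl (e, x.2)))
  | inr t => match pmatch (t, x.2) with
             | inl y => infc y
             | inr o => out (cmatch (inr o))
             end
  end.

Lemma close_match_out z : close_match (out z) = out (cmatch z).
Proof.
case: z => [[e i]|o] //=; rewrite /close_match /=.
by rewrite -surjective_pairing pmatch_att.
Qed.

Lemma close_match_in x y : pmatch x = inl y -> close_match (infc x) = infc y.
Proof. by rewrite /close_match /= -surjective_pairing => ->. Qed.

Lemma close_faceP (x : T * 'I_4) :
  (exists z, x = out z) \/ (exists y y', x = infc y /\ pmatch y = inl y').
Proof.
case: x => [[e|t] i]; first by left; exists (inl (e, i)).
case E: (pmatch (t, i)) => [y|o]; first by right; exists (t, i), y.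
by left; exists (inr o); rewrite /= (att_pmatch E).
Qed.

(** For connectedness, an invariant function is constant on the patch; [context_connected], applied
    with this constant on the labels, spreads it to the rest. *)
Lemma close_gluing : gluing close_sgn close_match.
Proof.
have sgn_out z : face_sgn close_sgn (out z) = end_val (face_sgn (@csgn C)) os z.
  by case: z => [//|o] /=; rewrite -(att_sgn L o).
split=> [|x|x|g gP].
- by rewrite card_sum addn_gt0 patch_nonempty orbT.
- have [[z ->]|[y [y' [-> yE]]]] := close_faceP x.
    by rewrite !close_match_out cmatchK.
  by rewrite !(close_match_in yE) (close_match_in (pmatch_invol yE)).
- have [[z ->]|[y [y' [-> yE]]]] := close_faceP x.
    by rewrite close_match_out !sgn_out cmatch_sgn.
  by rewrite (close_match_in yE); apply: pmatch_sgn yE.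
have [t0 _] : exists t0 : ptet L, t0 \in predT by apply/card_gt0P/patch_nonempty.
have gL t : g (inr t) = g (inr t0).
  apply: (patch_connected (g := g \o inr)) => x y xE /=.
  by have := gP (infc x); rewrite (close_match_in xE).
have gC e : g (inl e) = g (inr t0).
  apply: (context_connected (g := g \o inl)) => z.
  have gE w : end_val ((g \o inl) \o fst) (fun=> g (inr t0)) w = g (out w).1.
    by case: w => [//|o] /=; rewrite gL.
  by rewrite !gE -close_match_out gP.
by case=> [e|t] [e'|t']; rewrite ?gL ?gC.
Qed.

Definition cspine : spine := gluing_spine close_gluing.

Lemma cspine_pairing_out z : @pairing cspine (out z) = out (cmatch z).
Proof. by rewrite gluing_spine_pairing close_match_out. Qed.

Lemma cspine_pairing_in x y :
  pmatch x = inl y -> @pairing cspine (infc x) = infc y.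
Proof. by move=> xE; rewrite gluing_spine_pairing (close_match_in xE). Qed.

End Close.

End Patch.

Lemma opposite_lift (k : 'I_5) j : opposite k (lift k j) = j.
Proof. by rewrite /opposite liftK. Qed.

Lemma opposite_inj (k l m : 'I_5) :
  l != k -> m != k -> opposite k l = opposite k m -> l = m.
Proof.
rewrite ![_ == k]eq_sym => /unlift_some[j -> _] /unlift_some[j' -> _].
by rewrite !opposite_lift => ->.
Qed.

(* The relation [same_face] of the moves, for arbitrary maps and with the two
   sides of the bipyramid treated symmetrically. *)
Section Correspondence.

Variables (F K K' T T' : Type) (v : K -> 'I_5) (v' : K' -> 'I_5).
Variables (h : F + K -> T) (h' : F + K' -> T').

Definition corresponding (x : T * 'I_4) (x' : T' * 'I_4) : Prop :=
  (exists e i, x = (h (inl e), i) /\ x' = (h' (inl e), i)) \/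
  (exists k l, x = (h (inr k), opposite (v k) (v' l)) /\
               x' = (h' (inr l), opposite (v' l) (v k))).

Lemma corresponding_fun : injective h -> injective v' ->
    (forall k l, v' l != v k) ->
  forall x x1 x2, corresponding x x1 -> corresponding x x2 -> x1 = x2.
Proof.
move=> hI vI ne x x1 x2 [[e [i [-> ->]]]|[k [l [-> ->]]]].
  by case=> [[e' [i' [[/hI[->] ->] ->]]]|[k [l [[/hI]]]]].
case=> [[e' [i' [[/hI]]]]|[k' [l' [[/hI[<-] lE] ->]]]] //.
by have /vI -> := opposite_inj (ne _ _) (ne _ _) lE.
Qed.

End Correspondence.

Lemma correspondingC F K K' T T' v v' h h' x x' :
  @corresponding F K K' T T' v v' h h' x x' ->
  corresponding v' v h' h x' x.
Proof.
by case=> [[e [i [-> ->]]]|[k [l [-> ->]]]]; [left; exists e, i|right; exists l, k].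
Qed.

Section PatchMove.

Variables (O : Type) (os : O -> bool) (C : context os) (L L' : patch os).
Variables (A : {set 'I_5}) (F : finType) (eps : bool).
Variables (h : F + {k : 'I_5 | k \in A} -> ptet L).
Variables (h' : F + {k : 'I_5 | k \notin A} -> ptet L').

Let same := corresponding val val h h'.

Hypotheses (hB : bijective h) (h'B : bijective h').
Hypothesis sgnF : forall f, psgn (h' (inl f)) = psgn (h (inl f)).
Hypothesis sgnA : forall k, psgn (h (inr k)) = eps (+) odd (val k).
Hypothesis sgnA' : forall k, psgn (h' (inr k)) = ~~ eps (+) odd (val k).
Hypothesis inA : forall k l, val k != val l ->
  pmatch (h (inr k), opposite (val k) (val l)) =
    inl (h (inr l), opposite (val l) (val k)).
Hypothesis inA' : forall k l, val k != val l ->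
  pmatch (h' (inr k), opposite (val k) (val l)) =
    inl (h' (inr l), opposite (val l) (val k)).
Hypothesis same_att : forall o, same (att L o) (att L' o).
Hypothesis same_match : forall x x', same x x' ->
  match pmatch x, pmatch x' with
  | inl y, inl y' => same y y'
  | inr o, inr o' => o = o'
  | _, _ => False
  end.

Let hC B (M : finType) (g : F + B -> M) (z : (ctet C + F) + B) : ctet C + M :=
  match z with
  | inl (inl e) => inl e
  | inl (inr f) => inr (g (inl f))
  | inr k => inr (g (inr k))
  end.

Let hC_bij B (M : finType) (g : F + B -> M) : bijective g -> bijective (hC g).
Proof.
case=> g' gK g'K.
exists (fun t => match t with
  | inl e => inl (inl e)
  | inr t => match g' t with inl f => inl (inr f) | inr k => inr k end
  end).
- by case=> [[e|f]|k] //=; rewrite gK.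
- case=> [e|t] //=; case E: (g' t) => [f|k] /=; by rewrite -E g'K.
Qed.

Let val_neq (k : {k : 'I_5 | k \in A}) (l : {k : 'I_5 | k \notin A}) :
  val l != val k.
Proof. by apply: contraNneq (valP l) => ->; exact: valP k. Qed.

(** Corresponding faces have corresponding partners, whether these lie inside the patches
    ([same_match]) or are reached through the common context ([same_att]). The equivalence in
    [mp_replacement] follows because the correspondence is functional in both directions. *)
Lemma patch_move : mp_move_at A (cspine C L) (cspine C L').
Proof.
have hCB := hC_bij hB; have hCB' := hC_bij h'B.
exists (ctet C + F)%type, (hC h), (hC h'), eps; split=> //.
- by split=> [[e|f]|] //=; apply: sgnF.
- by move=> k l ne_kl; exact: (cspine_pairing_in C (inA ne_kl)).
- by move=> k l ne_kl; exact: (cspine_pairing_in C (inA' ne_kl)).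
pose sameC := corresponding val val (hC h) (hC h').
have same_in x x' : same x x' -> sameC (infc C x) (infc C x').
  case=> [[f [i [-> ->]]]|[k [l [-> ->]]]]; last by right; exists k, l.
  by left; exists (inr f), i.
have same_out z : sameC (out L z) (out L' z).
  case: z => [[e i]|o]; last exact: same_in.
  by left; exists (inl e), i.
have same_pairing x x' : sameC x x' ->
    sameC (@pairing (cspine C L) x) (@pairing (cspine C L') x').
  have same_in_pairing y y' : same y y' ->
      sameC (@pairing (cspine C L) (infc C y))
            (@pairing (cspine C L') (infc C y')).
    move=> yy'; have := same_match yy'.
    case yE: (pmatch y) => [w|o]; case yE': (pmatch y') => [w'|o'] // ww'.
      by rewrite (cspine_pairing_in _ yE) (cspine_pairing_in _ yE'); apply: same_in.
    rewrite -(att_pmatch yE) -(att_pmatch yE') -ww'.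
    have := same_out (cmatch (inr o)).
    by rewrite -!cspine_pairing_out.
  case=> [[[e|f] [i [-> ->]]]|[k [l [-> ->]]]].
  - have := same_out (cmatch (inl (e, i))).
    by rewrite -!cspine_pairing_out.
  - by apply: (same_in_pairing (_, _) (_, _)); left; exists f, i.
  - by apply: (same_in_pairing (_, _) (_, _)); right; exists k, l.
move=> x x' y y' xx' yy'; have xy := same_pairing _ _ xx'.
split=> E.
- rewrite E in xy; apply: (corresponding_fun _ _ _ xy) yy' => //.
  exact: bij_inj.
- rewrite E in xy; apply: (corresponding_fun _ _ _ (correspondingC xy)).
  + exact: bij_inj hCB'.
  + exact: val_inj.
  + by move=> k l; rewrite eq_sym.
  + exact: correspondingC.
Qed.

End PatchMove.

(** * Extracting a patch from a spine *)

Lemma fin_inj_surj_bij (T U : finType) (f : T -> U) :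
  injective f -> (forall u, exists t, f t = u) -> bijective f.
Proof.
move=> fI fS; apply: inj_card_bij => //; rewrite -(card_codom fI).
by apply/subset_leq_card/fintype.subsetP => u _; have [t <-] := fS u; apply: codom_f.
Qed.

Definition face_map (P Q : spine) (f : tet P -> tet Q) (x : face P) : face Q :=
  (f x.1, x.2).

Section PatchInSpine.

Variables (O : Type) (os : O -> bool) (L : patch os) (P : spine).
Variable phi : ptet L -> tet P.
Hypotheses (oP : ordered P) (phiI : injective phi).
Hypothesis phi_sgn : forall t, sgn (phi t) = psgn t.
Hypothesis phi_pairing : forall x y, pmatch x = inl y ->
  pairing (phi x.1, x.2) = (phi y.1, y.2).

Let E : finType := {u : tet P | u \notin codom phi}.

Let R (z : E * 'I_4 + O) : face P :=
  match z with
  | inl x => (val x.1, x.2)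
  | inr o => (phi (att L o).1, (att L o).2)
  end.

Let phi_out (e : E) t : val e <> phi t.
Proof. by move=> eE; have := valP e; rewrite eE codom_f. Qed.

Let R_inj : injective R.
Proof.
case=> [[e i]|o] [[e' i']|o'] //=.
- by case=> /val_inj -> ->.
- by case=> /phi_out.
- by case=> /esym/phi_out.
- case=> /phiI a1 a2; have := pmatch_att L o.
  by rewrite [att L o]surjective_pairing a1 a2 -surjective_pairing pmatch_att => -[->].
Qed.

Let R_in z y y' : pmatch y = inl y' -> R z <> (phi y.1, y.2).
Proof.
case: z => [[e i]|o] yE /= []; first by move/phi_out.
move=> /phiI a1 a2; have := pmatch_att L o.
by rewrite [att L o]surjective_pairing a1 a2 -surjective_pairing yE.
Qed.

Let RP (x : face P) : (exists z, x = R z) \/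
  (exists y y', x = (phi y.1, y.2) /\ pmatch y = inl y').
Proof.
case: x => u i; have [/codomP[t ->]|nu] := boolP (u \in codom phi); last first.
  by left; exists (inl (exist _ u nu, i)).
case tE: (pmatch (t, i)) => [y|o]; first by right; exists (t, i), y.
by left; exists (inr o); rewrite /= (att_pmatch tE).
Qed.

Let R_pairing z : exists w, R w = pairing (R z).
Proof.
have [[w ->]|[y [y' [yE y'E]]]] := RP (pairing (R z)); first by exists w.
have := pairingK (R z); rewrite yE (phi_pairing y'E) => /esym.
by move/(R_in (pmatch_invol y'E)).
Qed.

Let c z := projT1 (cid (R_pairing z)).

Let cE z : R (c z) = pairing (R z).
Proof. exact: projT2 (cid (R_pairing z)). Qed.

Let cK : involutive c.
Proof. by move=> z; apply: R_inj; rewrite !cE pairingK. Qed.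

Let cS (e : E) := sgn (val e).

Let c_sgn z :
  end_val (face_sgn cS) os (c z) = ~~ end_val (face_sgn cS) os z.
Proof.
have sE w : end_val (face_sgn cS) os w = face_sgn (@sgn P) (R w).
  by case: w => [//|o] /=; rewrite -(att_sgn L) /face_sgn /= phi_sgn.
by rewrite !sE cE (gluing_sgn (ordered_gluing oP)).
Qed.

Let c_connected (g : E -> bool) (b : bool) :
    (forall z, end_val (g \o fst) (fun=> b) (c z) =
               end_val (g \o fst) (fun=> b) z) ->
  forall e, g e = b.
Proof.
move=> gP e; pose G u := if insub u is Some e' then g e' else b.
have GR z : G (R z).1 = end_val (g \o fst) (fun=> b) z.
  case: z => [[e' i]|o] /=; rewrite /G.
    by case: insubP => [e1 _ /val_inj -> //|]; rewrite (valP e').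
  by rewrite insubN // negbK codom_f.
have Gphi t : G (phi t) = b by rewrite /G insubN // negbK codom_f.
have [t0 _] : exists t0 : ptet L, t0 \in predT by apply/card_gt0P/patch_nonempty.
have := gluing_connected (ordered_gluing oP) (g := G).
move=> /(_ _ (val e) (phi t0)); rewrite Gphi => GE.
have -> : g e = G (val e).
  by rewrite /G; case: insubP => [e' _ /val_inj -> //|]; rewrite (valP e).
apply: GE => x.
have [[z ->]|[y [y' [-> yE]]]] := RP x; first by rewrite -cE !GR gP.
by rewrite (phi_pairing yE) !Gphi.
Qed.

(** [R] enumerates the faces whose partner is not prescribed by the patch. [pairing] permutes them
    and, transported along [R], becomes the matching of the context. Free faces of the patch that
    are glued to each other in [P] give two matched labels. *)
Lemma extract_patch : exists (C : context os)
    (f : tet (cspine C L) -> tet P),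
  [/\ bijective f, forall t, sgn (f t) = sgn t,
      forall x, pairing (face_map f x) = face_map f (pairing x) &
      forall t, f (inr t) = phi t].
Proof.
pose C := Context cK c_sgn c_connected.
pose f (t : tet (cspine C L)) : tet P :=
  match t with inl e => val e | inr t => phi t end.
exists C, f; split=> //.
- apply: fin_inj_surj_bij.
    case=> [e|t] [e'|t'] //=; [|by move/phi_out|by move/esym/phi_out|].
      by move/val_inj->.
    by move/phiI->.
  move=> u; have [/codomP[t ->]|nu] := boolP (u \in codom phi).
    by exists (inr t).
  by exists (inl (exist _ u nu)).
- by case.
- have outE z : face_map f (out L z) = R z by case: z.
  move=> x; have [[z ->]|[y [y' [-> yE]]]] := close_faceP x.
    by rewrite cspine_pairing_out !outE cE.
  by rewrite (cspine_pairing_in _ yE); apply: phi_pairing.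
Qed.

End PatchInSpine.

(** * Snakes on a given germ, in a spine and in a patch *)

Definition snake_on (P Q : spine) (x : face P) : Prop :=
  exists h : tet P + bool -> tet Q,
    let emb (z : face P) : face Q := (h (inl z.1), z.2) in
    let p (i : nat) : face Q := (h (inr true), inord i) in
    let q (i : nat) : face Q := (h (inr false), inord i) in
    [/\ bijective h,
        forall t, sgn (h (inl t)) = sgn t,
        forall z, z <> x -> z <> pairing x ->
          pairing (emb z) = emb (pairing z) &
        [/\ pairing (emb x) = p 1%N, pairing (emb (pairing x)) = p 2%N,
            pairing (p 0%N) = q 0%N, pairing (p 3%N) = q 3%N &
            pairing (q 1%N) = q 2%N]].

Lemma snake_atP (P Q : spine) : snake_at P Q <-> exists x : face P, snake_on Q x.
Proof.
split=> [[h [x [y [hB hS <- hP hpq]]]]|[x [h [hB hS hP hpq]]]].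
  by exists x, h.
by exists h, x, (pairing x).
Qed.

Lemma ord4P (i : 'I_4) :
  [\/ i = inord 0, i = inord 1, i = inord 2 | i = inord 3].
Proof.
by case: i => [[|[|[|[|//]]]] lt_i4]; constructor; apply/val_inj; rewrite /= inordK.
Qed.

(** The requirements of [snake_on] leave no pairing undetermined, and they force the signs of the
    two added tetrahedra, because a pairing changes [face_sgn]. So a snake is determined by its
    germ, [x] and [pairing x] giving the two snakes on one edge. *)
Lemma snake_on_unique (P P' Q Q' : spine) (f : tet P -> tet P') (x : face P) :
    ordered P -> ordered P' -> ordered Q -> ordered Q' -> bijective f ->
    (forall t, sgn (f t) = sgn t) ->
    (forall z, pairing (face_map f z) = face_map f (pairing z)) ->
    snake_on Q x -> snake_on Q' (face_map f x) ->
  spine_iso Q Q'.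
Proof.
move=> oP oP' oQ oQ' fB fS fP.
case=> h [hB hS hP [px py p0 p3 q1]] [h' [hB' hS' hP' [px' py' p0' p3' q1']]].
have fI := bij_inj fB.
have FI : injective (face_map f) by move=> [t i] [u j] [/fI -> ->].
pose fh (t : tet P + bool) := match t with inl t => inl (f t) | inr b => inr b end.
have fhB : bijective fh.
  case: fB => g fK gK.
  exists (fun t => match t with inl t => inl (g t) | inr b => inr b end).
    by case=> //= t; rewrite fK.
  by case=> //= t; rewrite gK.
case: (hB) => hi hK Kh; pose k u := h' (fh (hi u)).
have kh t : k (h t) = h' (fh t) by rewrite /k hK.
have sgnQ z := gluing_sgn (ordered_gluing oQ) z.
have sgnQ' z := gluing_sgn (ordered_gluing oQ') z.
have sgn_p : sgn (h' (inr true)) = sgn (h (inr true)).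
  have := sgnQ (h (inl x.1), x.2); have := sgnQ' (h' (inl (f x.1)), x.2).
  rewrite px px' /face_sgn /= !inordK // hS hS' fS /=.
  by move: (sgn _) (sgn _) (sgn _) (odd _) => [] [] [] [].
have sgn_q : sgn (h' (inr false)) = sgn (h (inr false)).
  have := sgnQ (h (inr true), inord 0); have := sgnQ' (h' (inr true), inord 0).
  rewrite p0 p0' /face_sgn /= !inordK // sgn_p /=.
  by move: (sgn _) (sgn _) (sgn _) => [] [] [].
apply: (@ordered_iso _ _ k) => //.
- have hiB : bijective hi by exists h.
  exact: bij_comp hB' (bij_comp fhB hiB).
- move=> u; rewrite -(Kh u) kh; case: (hi u) => [t|[]] //=.
  by rewrite hS' fS hS.
pose kk (z : face Q) : face Q' := (k z.1, z.2).
have kP z w : pairing z = w -> pairing (kk z) = kk w ->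
    pairing (kk z) = kk (pairing z) /\ pairing (kk w) = kk (pairing w).
  by move=> <- kE; split=> //; rewrite -kE !pairingK.
have kE t i : kk (h t, i) = (h' (fh t), i) by rewrite /kk /= kh.
have [kx kp1] := kP _ _ px ltac:(rewrite !kE; exact: px').
have [ky kp2] := kP _ _ py ltac:(by rewrite !kE -py' fP).
have [kp0 kq0] := kP _ _ p0 ltac:(rewrite !kE; exact: p0').
have [kp3 kq3] := kP _ _ p3 ltac:(rewrite !kE; exact: p3').
have [kq1 kq2] := kP _ _ q1 ltac:(rewrite !kE; exact: q1').
move=> [u i]; change (pairing (kk (u, i)) = kk (pairing (u, i))).
rewrite -(Kh u); case: (hi u) => [t|b]; last by case: b; case: (ord4P i) => ->.
have [tx|ntx] := EM ((t, i) = x); first by rewrite -tx in kx.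
have [ty|nty] := EM ((t, i) = pairing x); first by rewrite -ty in ky.
rewrite (hP (t, i)) // !kE; have := hP' (face_map f (t, i)); rewrite !fP.
by apply=> /FI.
Qed.

Section PatchSnake.

Variables (O : Type) (os : O -> bool) (C : context os).

(** Labels act here as germs outside the patch, each paired with the face attached to it, so that a
    snake can be placed on either side of a free face. *)
Definition pend (L : patch os) (z : ptet L * 'I_4 + O) : ptet L * 'I_4 + O :=
  match z with inl x => pmatch x | inr o => inl (att L o) end.

(* A label stands for the face of the spine that is glued to the face attached
   to the label. *)
Definition end_face (L : patch os) (z : ptet L * 'I_4 + O) : face (cspine C L) :=
  match z with inl x => infc C x | inr o => out L (cmatch (inr o)) end.

Lemma pairing_end_face L z : pairing (@end_face L z) = end_face (pend z).
Proof.
case: z => [x|o] /=; last by rewrite cspine_pairing_out cmatchK.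
case xE: (pmatch x) => [y|o]; first exact: cspine_pairing_in.
by rewrite -(att_pmatch xE) /= -cspine_pairing_out.
Qed.

Variables (L L' : patch os) (j : ptet L -> ptet L') (p q : ptet L').
Variables (x y : ptet L * 'I_4 + O).

Definition emb_end (z : ptet L * 'I_4 + O) : ptet L' * 'I_4 + O :=
  match z with inl f => inl (j f.1, f.2) | inr o => inr o end.

Hypothesis jpqB : bijective (fun z : ptet L + bool =>
  match z with inl t => j t | inr b => if b then p else q end).
Hypothesis j_sgn : forall t, psgn (j t) = psgn t.
Hypothesis xy : pend x = y.
Hypothesis emb_pend : forall z, z <> x -> z <> y ->
  pend (emb_end z) = emb_end (pend z).
Hypothesis xp : pend (emb_end x) = inl (p, inord 1).
Hypothesis yp : pend (emb_end y) = inl (p, inord 2).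
Hypothesis p0 : pmatch (p, inord 0) = inl (q, inord 0).
Hypothesis p3 : pmatch (p, inord 3) = inl (q, inord 3).
Hypothesis q1 : pmatch (q, inord 1) = inl (q, inord 2).

Let h (z : (ctet C + ptet L) + bool) : ctet C + ptet L' :=
  match z with
  | inl (inl e) => inl e
  | inl (inr t) => inr (j t)
  | inr b => inr (if b then p else q)
  end.

Let hB : bijective h.
Proof.
case: jpqB => g gK Kg.
exists (fun t => match t with
  | inl e => inl (inl e)
  | inr t => match g t with inl t' => inl (inr t') | inr b => inr b end
  end).
- case=> [[e|t]|b] //=; first by have /= -> := gK (inl t).
  by have /= -> := gK (inr b).
- by case=> [e|t] //=; have := Kg t; case: (g t) => [t'|b] /= <-.
Qed.

Let emb (z : face (cspine C L)) : face (cspine C L') := (h (inl z.1), z.2).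

Let pendK (M : patch os) : involutive (@pend M).
Proof.
case=> [f|o] /=; last exact: pmatch_att.
case fE: (pmatch f) => [f'|o] /=; first exact: pmatch_invol fE.
by rewrite (att_pmatch fE).
Qed.

Let emb_out z : (forall o, z = inr o -> inr o <> x /\ inr o <> y) ->
  emb (out L z) = out L' z.
Proof.
case: z => [//|o] /(_ o erefl)[nx ny].
have /= aE := emb_pend nx ny; case: aE => aE /=.
by rewrite /emb /infc /= aE.
Qed.

Lemma patch_snake : @snake_on (cspine C L) (cspine C L') (end_face x).
Proof.
have yx : pend y = x by rewrite -xy pendK.
have xyE : pairing (end_face x) = end_face y by rewrite pairing_end_face xy.
have emb_end_face z w : (z = x /\ w = y) \/ (z = y /\ w = x) ->
    emb (end_face z) = end_face (emb_end z).
  move=> zw; have zwE : pend z = w by case: zw => -[-> ->].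
  case: z zw zwE => [//|o] zw /= zwE.
  apply: emb_out => o' oE.
  (* The outer face glued at [o] may itself be attached to a label [o']; signs exclude that a label
     is matched with itself. *)
  have oo' : inr o' <> inr o :> ptet L * 'I_4 + O.
    have := @cmatch_sgn _ _ C (inr o); rewrite oE /= => nE [oo']; move: nE.
    by rewrite oo'; case: (os o).
  case: zw => -[zE wE]; rewrite -zE -?wE -zwE; split=> //.
rewrite /snake_on xyE; exists h; split=> //.
- by case=> [e|t] //=; apply: j_sgn.
- move=> z nx ny; rewrite -/(emb z) -/(emb (pairing z)).
  have [[w zE]|[f [f' [zE fE]]]] := close_faceP z; rewrite zE in nx ny *; last first.
    have nfx : inl f <> x by move=> fx; apply: nx; rewrite -fx.
    have nfy : inl f <> y by move=> fy; apply: ny; rewrite -fy.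
    have /= := emb_pend nfx nfy; rewrite fE /= => fE'.
    by rewrite (cspine_pairing_in C fE) (cspine_pairing_in C fE').
  have end_out a o : inr o = a -> end_face (pend a) = out L (inr o) by move<-.
  have end_out' a o : inr o = a -> end_face a = out L (cmatch (inr o)) by move<-.
  rewrite cspine_pairing_out !emb_out ?cspine_pairing_out // => o oE; split=> oE'.
  + by apply: nx; rewrite (end_out' _ _ oE') -oE cmatchK.
  + by apply: ny; rewrite (end_out' _ _ oE') -oE cmatchK.
  + by apply: ny; rewrite -xy (end_out _ _ oE') -oE.
  + by apply: nx; rewrite -yx (end_out _ _ oE') -oE.
- rewrite -/(emb (end_face x)) -/(emb (end_face y)).
  rewrite (emb_end_face x y) ?(emb_end_face y x); [|by right|by left].
  rewrite !pairing_end_face xp yp; split=> //.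
  + exact: (cspine_pairing_in C p0).
  + exact: (cspine_pairing_in C p3).
  + exact: (cspine_pairing_in C q1).
Qed.

End PatchSnake.

(** * Numerical patches *)

Definition opp (k l : nat) : nat := if (l < k)%N then l else l.-1.

Lemma val_opposite (k l : 'I_5) : k != l -> opposite k l = opp k l :> nat.
Proof.
move=> /unlift_some[j -> _]; rewrite opposite_lift /opp /= /bump.
by case: leqP; lia.
Qed.

(* A patch given by the signs of its tetrahedra and by the table of an
   involution: a number [o <= n] is a label, [code n t i] is the face [i] of the
   tetrahedron [t]. *)
Definition npatch : Type := (seq bool * seq nat)%type.

(* The move with apexes [a] and [c], positive if [pos]: [nth 0 D k] is the number
   of the tetrahedron [D_k], before or after the move, and [keep] lists the old
   and new numbers of the tetrahedra not involved. *)
Record move := Move {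
  mv_pos : bool;
  mv_a : nat;
  mv_c : nat;
  mv_tet : seq nat;
  mv_keep : seq (nat * nat)
}.

Section NPatch.

Variables (n : nat) (os : seq bool).
Implicit Types (L : npatch) (z t : nat).

Definition code t (i : nat) : nat := n.+1 + (4 * t + i).
Definition ntets L : nat := size L.1.
Definition nbound L : nat := n.+1 + 4 * ntets L.
Definition nmatch L z : nat := nth 0 L.2 z.
Definition code_tet z : nat := (z - n.+1) %/ 4.
Definition code_idx z : nat := (z - n.+1) %% 4.
(* A label has the sign opposite to that of the face attached to it, so that the
   involution always changes signs. *)
Definition nsign L z : bool :=
  if (z < n.+1)%N then ~~ nth false os z
  else nth false L.1 (code_tet z) (+) odd (code_idx z).

(** One round of exploration from the tetrahedra in [s]; the test [n < z] prevents crossing a label.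
    Its iteration from tetrahedron 0 certifies connectedness in [nvalid]. *)
Definition nstep L (s : seq nat) : seq nat :=
  s ++ [seq t <- iota 0 (ntets L) | has (fun i =>
    let z := nmatch L (code t i) in (n < z)%N && (code_tet z \in s)) (iota 0 4)].

Definition nvalid L : bool :=
  [&& (0 < ntets L)%N,
      all (fun z => [&& (nmatch L z < nbound L)%N, nmatch L (nmatch L z) == z,
                        nsign L (nmatch L z) == ~~ nsign L z &
                        (z <= n)%N ==> (n < nmatch L z)%N])
          (iota 0 (nbound L)) &
      all (mem (iter (ntets L) (nstep L) [:: 0%N])) (iota 0 (ntets L))].

Lemma code_tetK t (i : 'I_4) : code_tet (code t i) = t.
Proof.
by rewrite /code_tet /code addKn mulnC divnMDl // divn_small ?addn0.
Qed.

Lemma code_idxK t (i : 'I_4) : code_idx (code t i) = i.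
Proof. by rewrite /code_idx /code addKn mulnC modnMDl modn_small. Qed.

Lemma code_lt L t (i : 'I_4) : (t < ntets L)%N -> (code t i < nbound L)%N.
Proof. by rewrite /code /nbound; have := ltn_ord i; lia. Qed.

Lemma leq_code t i : (n < code t i)%N.
Proof. by rewrite /code; lia. Qed.

Lemma codeK z : (n < z)%N -> code (code_tet z) (code_idx z) = z.
Proof.
move=> lt_nz; rewrite /code /code_tet /code_idx [(4 * _)%N]mulnC -divn_eq.
by rewrite subnKC.
Qed.

Section Typed.

Variables (b : bool) (L : npatch).

(** The successor form makes the type inhabited, as [ord0] and [inord] require; it has the intended
    size once [ntets L] is positive. *)
Definition tets : finType := 'I_(ntets L).-1.+1.

Definition enc (w : tets * 'I_4 + 'I_n.+1) : nat :=
  match w with inl x => code x.1 x.2 | inr o => o end.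

Definition dec z : tets * 'I_4 + 'I_n.+1 :=
  if (z <= n)%N then inr (inord z)
  else inl (inord (code_tet z), inord (code_idx z)).

Lemma encK : cancel enc dec.
Proof.
case=> [[t i]|o]; rewrite /dec /=.
  by rewrite leqNgt leq_code /= code_tetK code_idxK !inord_val.
by rewrite -ltnS ltn_ord inord_val.
Qed.

Hypothesis L_gt0 : (0 < ntets L)%N.

Lemma tet_lt (t : tets) : (t < ntets L)%N.
Proof. by apply: leq_trans (ltn_ord t) _; rewrite prednK. Qed.

Lemma enc_lt w : (enc w < nbound L)%N.
Proof.
case: w => [[t i]|o] /=; last by rewrite /nbound; have := ltn_ord o; lia.
by apply/code_lt/tet_lt.
Qed.

Lemma decK z : (z < nbound L)%N -> enc (dec z) = z.
Proof.
rewrite /nbound => lt_z; rewrite /dec; case: leqP => [le_zn|lt_nz] /=.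
  by rewrite inordK.
rewrite !inordK ?codeK // ?ltn_mod // prednK //.
by rewrite /code_tet ltn_divLR //; lia.
Qed.

Hypothesis V : nvalid L.

Let Lz z : (z < nbound L)%N ->
  [/\ (nmatch L z < nbound L)%N, nmatch L (nmatch L z) = z,
      nsign L (nmatch L z) = ~~ nsign L z &
      (z <= n)%N -> (n < nmatch L z)%N].
Proof.
move=> lt_z; have /and3P[_ /allP/(_ z) zP _] := V; move: zP.
by rewrite mem_iota => /(_ lt_z)/and4P[-> /eqP-> /eqP-> /implyP].
Qed.

Definition tmatch (w : tets * 'I_4 + 'I_n.+1) := dec (nmatch L (enc w)).

Lemma enc_tmatch w : enc (tmatch w) = nmatch L (enc w).
Proof. by apply: decK; case: (Lz (enc_lt w)). Qed.

Lemma tmatchK : involutive tmatch.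
Proof.
move=> w; rewrite {1}/tmatch enc_tmatch.
by case: (Lz (enc_lt w)) => _ -> _ _; rewrite encK.
Qed.

Definition tatt (o : 'I_n.+1) : tets * 'I_4 :=
  match tmatch (inr o) with inl x => x | inr _ => (ord0, ord0) end.

(** [nvalid] forbids two matched labels, so the default branch of [tatt] is never reached. *)
Lemma tmatch_inr o : tmatch (inr o) = inl (tatt o).
Proof.
rewrite /tatt /tmatch /dec /=; case: leqP => // le_n.
have [_ _ _] := Lz (enc_lt (inr o)); rewrite /= -ltnS ltn_ord => /(_ isT).
by rewrite ltnNge le_n.
Qed.

(* The mirror image of a move or of a snake is again one, whence the sign [b]. *)
Definition tsgn (t : tets) : bool := b (+) nth false L.1 t.
Definition tos (o : 'I_n.+1) : bool := b (+) nth false os o.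

Let nsign_enc w : nsign L (enc w) =
  match w with inl x => b (+) face_sgn tsgn x | inr o => ~~ (b (+) tos o) end.
Proof.
rewrite /nsign; case: w => [[t i]|o] /=.
  by rewrite ltnS leqNgt leq_code /= code_tetK code_idxK /face_sgn /tsgn addbA addKb.
by rewrite ltn_ord /tos addKb.
Qed.

Let nsign_tmatch w : nsign L (enc (tmatch w)) = ~~ nsign L (enc w).
Proof. by rewrite enc_tmatch; case: (Lz (enc_lt w)). Qed.

Fact tpatch_nonempty : (0 < #|tets|)%N.
Proof. by rewrite card_ord. Qed.

Fact tpatch_att_sgn o : face_sgn tsgn (tatt o) = tos o.
Proof.
have := nsign_tmatch (inr o); rewrite tmatch_inr !nsign_enc negbK.
exact: addbI.
Qed.

Fact tpatch_match_att o : tmatch (inl (tatt o)) = inr o.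
Proof. by rewrite -tmatch_inr tmatchK. Qed.

Fact tpatch_att_match x o : tmatch (inl x) = inr o -> tatt o = x.
Proof. by move=> xo; have := tmatch_inr o; rewrite -xo tmatchK => -[]. Qed.

Fact tpatch_invol x y : tmatch (inl x) = inl y -> tmatch (inl y) = inl x.
Proof. by move=> <-; rewrite tmatchK. Qed.

Fact tpatch_sgn x y : tmatch (inl x) = inl y ->
  face_sgn tsgn y = ~~ face_sgn tsgn x.
Proof.
move=> xy; have := nsign_tmatch (inl x); rewrite xy !nsign_enc -addbN.
exact: addbI.
Qed.

Fact tpatch_connected (g : tets -> bool) :
  (forall x y, tmatch (inl x) = inl y -> g y.1 = g x.1) ->
  forall t u : tets, g t = g u.
Proof.
move=> gP; have g0 (t : tets) : g t = g ord0; last by move=> t u; rewrite !g0.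
have /and3P[_ _ /allP/(_ (val t)) tP] := V; move: tP.
rewrite mem_iota tet_lt => /(_ isT).
suff g_iter k : forall u : tets,
    (u : nat) \in iter k (nstep L) [:: 0%N] -> g u = g ord0 by move/g_iter.
elim: k => [|k IHk] {}t.
  by rewrite /= inE => /eqP t0; congr g; apply: val_inj.
rewrite iterS /nstep mem_cat => /orP[/IHk //|].
rewrite mem_filter => /andP[/hasP[i i4 /= /andP[lt_nz zk]] _].
have {i4} lt_i4 : (i < 4)%N by move: i4; rewrite mem_iota.
have := enc_tmatch (inl (t, Ordinal lt_i4)).
case E: (tmatch _) => [y|o] /=; last first.
  by move=> oE; rewrite -oE in lt_nz; have := ltn_ord o; lia.
move=> yE; rewrite -(gP _ _ E); apply: IHk.
by rewrite -yE code_tetK in zk.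
Qed.

Definition tpatch : patch tos :=
  @Patch _ tos tets tsgn tatt (tmatch \o inl) tpatch_nonempty tpatch_att_sgn
    tpatch_match_att tpatch_att_match tpatch_invol tpatch_sgn tpatch_connected.

End Typed.
End NPatch.

Lemma nvalid_gt0 n os L : nvalid n os L -> (0 < ntets L)%N.
Proof. by case/and3P. Qed.

Definition vpatch n os b L (V : nvalid n os L) : patch (@tos n os b) :=
  tpatch b (nvalid_gt0 V) V.

(** * Moves on numerical patches *)

Section NMove.

Variables (n : nat) (os : seq bool).
Implicit Types (L : npatch).

Definition apexes (a c k : nat) : bool := (k == a) || (k == c).
Definition labels (B : pred nat) : seq nat := [seq k <- iota 0 5 | B k].

Definition nsame (B : pred nat) (D : seq nat) (ren : seq (nat * nat)) :
    seq (nat * nat) :=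
  [seq (code n p.1 i, code n p.2 i) | p <- ren, i <- iota 0 4] ++
  [seq (code n (nth 0 D k) (opp k l), code n (nth 0 D l) (opp l k)) |
     k <- labels B, l <- labels (predC B)].

Definition ninner L (B : pred nat) (D : seq nat) : bool :=
  all (fun k => all (fun l => (k != l) ==>
    (nmatch L (code n (nth 0 D k) (opp k l)) == code n (nth 0 D l) (opp l k)))
    (labels B)) (labels B).

(** The hypotheses of [patch_move] and the sliding condition as one boolean; [eps] is read off the
    tetrahedron [D_a], whose sign must be [eps (+) odd a]. *)
Definition nmove L L' a c D ren : bool :=
  let B := apexes a c in
  let eps := nth false L.1 (nth 0 D a) (+) odd a in
  let same := nsame B D ren in
  [&& [&& (a < c)%N, (c < 5)%N, (a, c) != (0, 1)%N & (a, c) != (3, 4)%N],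
      perm_eq (unzip1 ren ++ map (nth 0 D) (labels B)) (iota 0 (ntets L)),
      perm_eq (unzip2 ren ++ map (nth 0 D) (labels (predC B)))
              (iota 0 (ntets L')),
      all (fun p => nth false L'.1 p.2 == nth false L.1 p.1) ren,
      all (fun k => nth false L.1 (nth 0 D k) == eps (+) odd k) (labels B),
      all (fun k => nth false L'.1 (nth 0 D k) == ~~ eps (+) odd k)
          (labels (predC B)),
      ninner L B D, ninner L' (predC B) D,
      all (fun o => (nmatch L o, nmatch L' o) \in same) (iota 0 n.+1) &
      all (fun p => if (nmatch L p.1 <= n)%N
                    then nmatch L' p.2 == nmatch L p.1
                    else (nmatch L p.1, nmatch L' p.2) \in same) same].

(* Nothing needs to be proved about [napply], since [nrun] checks its result. *)
Definition napply (m : move) L : npatch :=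
  let: Move pos a c D ren := m in
  let A := apexes a c in
  let B := if pos then A else predC A in
  let same := nsame B D ren in
  let trans s s' z := if (z <= n)%N then z else nth 0 s' (index z s) in
  let inner := [seq (code n (nth 0 D p.1) (opp p.1 p.2),
                     code n (nth 0 D p.2) (opp p.2 p.1)) |
    p <- [seq p <- [seq (k, l) | k <- labels (predC B), l <- labels (predC B)]
         | p.1 != p.2]] in
  let M := if pos then (ntets L).+1 else (ntets L).-1 in
  let k0 := head 0 (labels B) in
  let eps := nth false L.1 (nth 0 D k0) (+) odd k0 in
  (mkseq (fun t => if t \in unzip2 ren
     then nth false L.1 (nth 0 (unzip1 ren) (index t (unzip2 ren)))
     else ~~ eps (+) odd (nth 0 (labels (predC B))
       (index t (map (nth 0 D) (labels (predC B)))))) M,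
   mkseq (fun z => if z \in unzip1 inner
     then nth 0 (unzip2 inner) (index z (unzip1 inner))
     else trans (unzip1 same) (unzip2 same)
            (nmatch L (trans (unzip2 same) (unzip1 same) z))) (n.+1 + 4 * M)).

Fixpoint nrun L (ms : seq move) : option npatch :=
  if ms is m :: ms' then
    let L' := napply m L in
    let: Move pos a c D ren := m in
    if nvalid n os L' &&
       (if pos then nmove L L' a c D ren
        else nmove L' L a c D [seq (p.2, p.1) | p <- ren])
    then nrun L' ms' else None
  else Some L.

Section Soundness.

Variables (b : bool) (L L' : npatch).
Hypotheses (V : nvalid n os L) (V' : nvalid n os L').

(** A repetition-free list of all tetrahedra, cut into those kept and those of the bipyramid, is a
    bijection from a sum type; [pos] is the place in the uncut list. *)
Let sum_bij (B : pred nat) (B' : pred 'I_5) (D s : seq nat) r (M : npatch) :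
    size s = r -> (forall k : 'I_5, B' k = B k) -> (0 < ntets M)%N ->
    perm_eq (s ++ map (nth 0 D) (labels B)) (iota 0 (ntets M)) ->
  let g (z : 'I_r + {k : 'I_5 | B' k}) : tets M := match z with
    | inl f => inord (nth 0 s f)
    | inr k => inord (nth 0 D (val k))
    end in
  bijective g /\ forall z, g z = match z with
    | inl f => nth 0 s f
    | inr k => nth 0 D (val k)
    end :> nat.
Proof.
move=> sr BB'; subst r; set s' := map _ _ => M_gt0 s_perm g.
have s_uniq : uniq (s ++ s') by rewrite (perm_uniq s_perm) iota_uniq.
have s_mem u : (u \in s ++ s') = (u < ntets M)%N.
  by rewrite (perm_mem s_perm) mem_iota.
have k_lab (k : {k : 'I_5 | B' k}) : val (val k) \in labels B.
  by rewrite mem_filter mem_iota /= -BB' (valP k) /= ltn_ord.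
have inordE u : u \in s ++ s' -> (inord u : tets M) = u :> nat.
  by rewrite s_mem => lt_u; rewrite inordK // prednK.
pose pos (z : 'I_(size s) + {k : 'I_5 | B' k}) := match z with
  | inl f => val f
  | inr k => size s + index (val (val k)) (labels B)
  end.
have pos_lt z : (pos z < size (s ++ s'))%N.
  rewrite size_cat size_map; case: z => [f|k] /=.
    by apply: leq_trans (ltn_ord f) (leq_addr _ _).
  rewrite ltn_add2l index_mem; exact: (k_lab k).
have g_val z : g z = match z with
    | inl f => nth 0 s f
    | inr k => nth 0 D (val k)
    end :> nat.
  by case: z => [f|k]; rewrite /= inordE // mem_cat ?mem_nth ?map_f ?orbT //;
    exact: (k_lab k).
split=> //.
have gE z : g z = nth 0 (s ++ s') (pos z) :> nat.
  rewrite g_val nth_cat; case: z => [f|k] /=; first by rewrite ltn_ord.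
  rewrite ltnNge leq_addr /= addKn (nth_map 0) ?index_mem ?nth_index //;
    exact: (k_lab k).
apply: fin_inj_surj_bij.
  move=> z w zw; have {zw} : pos z = pos w.
    apply/eqP; rewrite -(nth_uniq 0 (pos_lt z) (pos_lt w) s_uniq) -!gE.
    by rewrite zw.
  case: z w => [f|k] [f'|k'] /=.
  - by move/val_inj->.
  - by have := ltn_ord f; lia.
  - by have := ltn_ord f'; lia.
  - move/addnI => kk'; congr inr; apply/val_inj/val_inj.
    by have := nth_index 0 (k_lab k); rewrite kk' (nth_index 0 (k_lab k')) => <-.
move=> u; have : (u : nat) \in s ++ s' by rewrite s_mem tet_lt.
rewrite mem_cat => /orP[/(nthP 0)[i lt_i iu]|/mapP[k]].
  exists (inl (Ordinal lt_i)); apply: val_inj => /=.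
  by rewrite inordE iu ?s_mem ?tet_lt.
rewrite mem_filter mem_iota => /andP[Bk lt_k5] uk.
have {}Bk : B' (Ordinal lt_k5) by rewrite BB'.
exists (inr (exist (fun k : 'I_5 => B' k) (Ordinal lt_k5) Bk)).
by apply: val_inj => /=; rewrite inordE -uk ?s_mem ?tet_lt.
Qed.


Variables (a c : nat) (D : seq nat) (ren : seq (nat * nat)).
Hypothesis LL' : nmove L L' a c D ren.

Let B := apexes a c.
Let A : {set 'I_5} := [set k : 'I_5 | B k]%SET.

Let K := {k : 'I_5 | k \in A}.
Let K' := {k : 'I_5 | k \notin A}.

Let ex_h : exists h : 'I_(size ren) + K -> tets L,
  bijective h /\ forall z, h z = match z with
    | inl f => nth 0 (unzip1 ren) f
    | inr k => nth 0 D (val k)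
    end :> nat.
Proof.
eexists; apply: (@sum_bij B); rewrite ?size_map ?(nvalid_gt0 V) //.
  by move=> k; rewrite inE.
by case/and5P: LL'.
Qed.

Let ex_h' : exists h' : 'I_(size ren) + K' -> tets L',
  bijective h' /\ forall z, h' z = match z with
    | inl f => nth 0 (unzip2 ren) f
    | inr k => nth 0 D (val k)
    end :> nat.
Proof.
eexists; apply: (@sum_bij (predC B)); rewrite ?size_map ?(nvalid_gt0 V') //.
  by move=> k; rewrite inE.
by case/and5P: LL'.
Qed.

Section Maps.

Variables (h : 'I_(size ren) + K -> tets L) (h' : 'I_(size ren) + K' -> tets L').
Hypotheses (hB : bijective h) (h'B : bijective h').
Hypothesis hE : forall z, h z = match z with
    | inl f => nth 0 (unzip1 ren) f
    | inr k => nth 0 D (val k)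
    end :> nat.
Hypothesis h'E : forall z, h' z = match z with
    | inl f => nth 0 (unzip2 ren) f
    | inr k => nth 0 D (val k)
    end :> nat.

Let same := corresponding val val h h'.

Let same_enc x x' : same x x' ->
  (enc (n := n) (inl x), enc (n := n) (inl x')) \in nsame B D ren.
Proof.
rewrite mem_cat; case=> [[f [i [-> ->]]]|[k [l [-> ->]]]]; apply/orP.
  left; apply/allpairsP; exists (nth (0, 0)%N ren f, val i).
  rewrite mem_nth // mem_iota ltn_ord /= hE h'E.
  by rewrite !(nth_map (0, 0)%N).
right; apply/allpairsP; exists (val (val k), val (val l)).
have Bk : B (val k) by have := valP k; rewrite inE.
have Bl : ~~ B (val l) by have := valP l; rewrite inE.
have kl : val k != val l by apply: contraNneq Bl => <-.
rewrite !mem_filter !mem_iota /= Bk Bl !ltn_ord /= hE h'E.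
by rewrite !val_opposite // eq_sym.
Qed.

Let enc_same z z' : (z, z') \in nsame B D ren ->
  exists x x', [/\ same x x', z = enc (n := n) (inl x) & z' = enc (n := n) (inl x')].
Proof.
rewrite mem_cat => /orP[/allpairsP[[p i] [pr i4 /= [-> ->]]]|].
  have {i4} lt_i4 : (i < 4)%N by move: i4; rewrite mem_iota.
  have lt_p : (index p ren < size ren)%N by rewrite index_mem.
  pose f := Ordinal lt_p.
  exists (h (inl f), Ordinal lt_i4), (h' (inl f), Ordinal lt_i4).
  split; first by left; exists f, (Ordinal lt_i4).
    by rewrite /= hE (nth_map (0, 0)%N) //= nth_index.
  by rewrite /= h'E (nth_map (0, 0)%N) //= nth_index.
case/allpairsP=> -[k l] /= [].
rewrite !mem_filter !mem_iota /= => /andP[Bk lt_k] /andP[Bl lt_l] [-> ->].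
have kA : Ordinal lt_k \in A by rewrite inE.
have lA : Ordinal lt_l \notin A by rewrite inE.
have kl : Ordinal lt_k != Ordinal lt_l by apply: contraNneq lA => <-.
pose k' : {k : 'I_5 | k \in A} := exist (fun k : 'I_5 => k \in A) _ kA.
pose l' : {k : 'I_5 | k \notin A} := exist (fun k : 'I_5 => k \notin A) _ lA.
exists (h (inr k'), opposite (val k') (val l')).
exists (h' (inr l'), opposite (val l') (val k')).
split; first by right; exists k', l'.
  by rewrite /= hE /= val_opposite.
by rewrite /= h'E /= val_opposite // eq_sym.
Qed.

Lemma nmove_at (C : context (@tos n os b)) :
  mp_move_at A (cspine C (vpatch b V)) (cspine C (vpatch b V')).
Proof.
case/and5P: LL' => _ _ _ /allP sF /and5P[/allP sA /allP sA' iA iA'].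
case/andP=> /allP satt /allP smatch.
have B_lab (k : {k : 'I_5 | k \in A}) : val (val k) \in labels B.
  by rewrite mem_filter mem_iota; have := valP k; rewrite inE /= => ->; rewrite ltn_ord.
have B_lab' (k : {k : 'I_5 | k \notin A}) : val (val k) \in labels (predC B).
  by rewrite mem_filter mem_iota; have := valP k; rewrite inE /= => ->; rewrite ltn_ord.
apply: (@patch_move _ _ C (vpatch b V) (vpatch b V') A _
  (b (+) (nth false L.1 (nth 0 D a) (+) odd a)) h h') => //.
- move=> f; rewrite /= /tsgn hE h'E !(nth_map (0, 0)%N) //; congr addb.
  by apply/eqP/sF/mem_nth.
- move=> k; rewrite /= /tsgn hE (eqP (sA _ (B_lab k))) !addbA //.
- move=> k; rewrite /= /tsgn h'E (eqP (sA' _ (B_lab' k))).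
  by move: b (nth _ L.1 _) (odd a) (odd (val k)) => [] [] [] [].
- move=> k l kl; rewrite /= /tmatch /= hE.
  have /allP/(_ _ (B_lab k))/allP/(_ _ (B_lab l))/implyP/(_ kl)/eqP := iA.
  have hEl : nth 0 D (val l) = h (inr l) by rewrite hE.
  rewrite val_opposite // => ->; rewrite -val_opposite 1?eq_sym // hEl.
  exact: (encK (inl (h (inr l), _))).
- move=> k l kl; rewrite /= /tmatch /= h'E.
  have /allP/(_ _ (B_lab' k))/allP/(_ _ (B_lab' l))/implyP/(_ kl)/eqP := iA'.
  have hEl : nth 0 D (val l) = h' (inr l) by rewrite h'E.
  rewrite val_opposite // => ->; rewrite -val_opposite 1?eq_sym // hEl.
  exact: (encK (inl (h' (inr l), _))).
- move=> o; have o_lt : (o : nat) \in iota 0 n.+1 by rewrite mem_iota ltn_ord.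
  have [x [x' [xx' xE x'E]]] := enc_same (satt _ o_lt).
  by rewrite /= /tatt /tmatch /= xE x'E !encK.
- move=> x x' xx'; have := smatch _ (same_enc xx'); rewrite /= /tmatch.
  case: leqP => [le_z /eqP -> |lt_z /enc_same[y [y' [yy' -> ->]]]].
    by rewrite /dec le_z.
  by rewrite !encK.
Qed.

End Maps.

Let card_A : [/\ #|A| = 2%N, A != [set k : 'I_5 | (k < 2)%N]%SET &
  A != [set k : 'I_5 | (2 < k)%N]%SET].
Proof.
case/and4P: LL' => /and4P[ac c5 n01 n34] _ _ _.
have a5 := ltn_trans ac c5.
have -> : A = [set Ordinal a5; Ordinal c5]%SET.
  by apply/setP => k; rewrite !inE -!val_eqE.
split; first by rewrite cards2 -val_eqE /= neq_ltn ac.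
  apply: contraNneq n01 => /setP E; have := E (Ordinal a5).
  have := E (Ordinal c5); rewrite !inE -!val_eqE /= !eqxx orbT /=.
  by move=> /esym c2 /esym a2; rewrite xpair_eqE; lia.
apply: contraNneq n34 => /setP E; have := E (Ordinal a5).
have := E (Ordinal c5); rewrite !inE -!val_eqE /= !eqxx orbT /=.
by move=> /esym c2 /esym a2; rewrite xpair_eqE; lia.
Qed.

Lemma nmove_sound (C : context (@tos n os b)) :
  positive_sliding_move (cspine C (vpatch b V)) (cspine C (vpatch b V')).
Proof.
exists (cspine C (vpatch b V)), (cspine C (vpatch b V')).
split=> //; try exact: spine_iso_refl.
exists A; have [A2 A01 A34] := card_A; split=> //.
have [h [hB hE]] := ex_h; have [h' [h'B h'E]] := ex_h'.
exact: nmove_at hB h'B hE h'E C.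
Qed.

End Soundness.
End NMove.

(** * Soundness of sequences of moves and of numerical snakes *)

Section Runs.

Variables (n : nat) (os : seq bool).
Implicit Types (L : npatch).

Notation rel_sliding := (related positive_sliding_move).

Lemma nrun_cons L pos a c D ren ms :
  let L' := napply n (Move pos a c D ren) L in
  nrun n os L (Move pos a c D ren :: ms) =
  if nvalid n os L' &&
     (if pos then nmove n L L' a c D ren
      else nmove n L' L a c D [seq (p.2, p.1) | p <- ren])
  then nrun n os L' ms else None.
Proof. by []. Qed.

(** Each step has been rechecked by [nmove]; a negative move is a positive one read from its result,
    with the pairs in [ren] reversed. *)
Lemma nrun_sound ms L L' (V : nvalid n os L) (V' : nvalid n os L') b
    (C : context (@tos n os b)) : nrun n os L ms = Some L' ->
  rel_sliding (cspine C (vpatch b V)) (cspine C (vpatch b V')).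
Proof.
elim: ms L V => [|[pos a c D ren] ms IHms] L V.
  by case=> LL'; subst L'; rewrite (bool_irrelevance V V'); apply: rst_refl.
rewrite nrun_cons; set L1 := napply _ _ _.
case: andP => // -[V1 mv] run1; apply: rst_trans (IHms _ V1 run1).
move: @L1 V1 mv {run1}; case: pos => L1 V1 mv.
  by apply: rst_step; right; apply: nmove_sound mv _.
by apply/rst_sym/rst_step; right; apply: nmove_sound mv _.
Qed.

Lemma nrun_positive a c D ren ms L L' (V : nvalid n os L) b
    (C : context (@tos n os b)) :
    nrun n os L (Move true a c D ren :: ms) = Some L' ->
  exists Q, positive_sliding_move (cspine C (vpatch b V)) Q.
Proof.
rewrite nrun_cons; case: andP => // -[V1 mv] _.
by exists (cspine C (vpatch b V1)); apply: nmove_sound mv _.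
Qed.

(* If [x] is a label, the snake is put on the germ glued to the patch there. *)
Definition nsnake L x : npatch :=
  let y := nmatch L x in
  let p := code n (ntets L) in
  let q := code n (ntets L).+1 in
  let s := nsign n os L x in
  (L.1 ++ [:: s; ~~ s],
   set_nth 0 (set_nth 0 L.2 x (p 1)) y (p 2) ++
     [:: q 0; x; y; q 3; p 0; q 2; q 1; p 3])%N.

Definition nsnake_ok L L' x : bool :=
  let y := nmatch L x in
  let p := code n (ntets L) in
  let q := code n (ntets L).+1 in
  [&& ntets L' == (ntets L).+2, (x < nbound n L)%N,
      all (fun t => nth false L'.1 t == nth false L.1 t) (iota 0 (ntets L)),
      all (fun z => [|| z == x, z == y | nmatch L' z == nmatch L z])
          (iota 0 (nbound n L)) &
      [&& nmatch L' x == p 1, nmatch L' y == p 2, nmatch L' (p 0) == q 0,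
          nmatch L' (p 3) == q 3 & nmatch L' (q 1) == q 2]]%N.

Lemma inord_tet L t : (t < ntets L)%N -> (inord t : tets L) = t :> nat.
Proof. by move=> lt_t; apply: inordK; case: (ntets L) lt_t. Qed.

Lemma nsnake_sound L L' x (V : nvalid n os L) (V' : nvalid n os L') b
    (C : context (@tos n os b)) : nsnake_ok L L' x ->
  @snake_on (cspine C (vpatch b V)) (cspine C (vpatch b V'))
    (@end_face _ _ C (vpatch b V) (dec n L x)).
Proof.
case/and5P=> /eqP szL' lt_x /allP sgnP /allP matchP /and5P[].
move=> /eqP xp /eqP yp /eqP p0 /eqP p3 /eqP q1.
have L_gt0 := nvalid_gt0 V; have L'_gt0 := nvalid_gt0 V'.
pose j (t : tets L) : tets L' := inord t.
pose p : tets L' := inord (ntets L); pose q : tets L' := inord (ntets L).+1.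
have jE t : j t = t :> nat.
  by rewrite inord_tet // szL'; have := tet_lt L_gt0 t; lia.
have pE : p = ntets L :> nat by rewrite inord_tet // szL'.
have qE : q = (ntets L).+1 :> nat by rewrite inord_tet // szL'.
have pendE M (W : nvalid n os M) z :
    @pend _ _ (vpatch b W) z = tmatch z.
  by case: z => [f|o] //=; rewrite (tmatch_inr (nvalid_gt0 W) W).
have encj z : enc (@emb_end _ _ (vpatch b V) (vpatch b V') j z) = enc z.
  by case: z => [f|o] //=; rewrite jE.
have enc_inj M : injective (@enc n M) by apply: can_inj (@encK _ _).
have enc_pend M (W : nvalid n os M) z :
    enc (@pend _ _ (vpatch b W) z) = nmatch M (enc z).
  by rewrite pendE (enc_tmatch (nvalid_gt0 W) W).
have xE : enc (dec n L x) = x by rewrite decK.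
have iE k : (k < 4)%N -> (inord k : 'I_4) = k :> nat by move=> ?; rewrite inordK.
apply: (@patch_snake _ _ C (vpatch b V) (vpatch b V') j p q (dec n L x)
  (@pend _ _ (vpatch b V) (dec n L x))) => //.
- apply: fin_inj_surj_bij.
    case=> [t|[]] [t'|[]] //= /(congr1 val) /=; rewrite ?jE ?pE ?qE.
    + by move/val_inj->.
    + by have := tet_lt L_gt0 t; lia.
    + by have := tet_lt L_gt0 t; lia.
    + by have := tet_lt L_gt0 t'; lia.
    + by lia.
    + by have := tet_lt L_gt0 t'; lia.
    + by lia.
  move=> u; have lt_u : (u <= (ntets L).+1)%N.
    by rewrite -ltnS -szL'; apply: tet_lt.
  case: (ltngtP u (ntets L)) => [ltu|gtu|uE].
  + exists (inl (inord u)); apply: val_inj; rewrite /= jE !inord_tet //.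
  + by exists (inr false); apply: ord_inj; rewrite /= qE; lia.
  + by exists (inr true); apply: ord_inj; rewrite /= pE.
- move=> t; rewrite /= /tsgn jE; congr addb; apply/eqP/sgnP.
  by rewrite mem_iota; apply: tet_lt.
- move=> z zx zy; apply: (enc_inj L'); rewrite enc_pend !encj enc_pend.
  have /matchP : enc z \in iota 0 (nbound n L).
    by rewrite mem_iota; apply: enc_lt.
  case/or3P=> /eqP zE //.
    by have := zx (enc_inj L _ _ (etrans zE (esym xE))).
  by case: zy; apply: (enc_inj L); rewrite enc_pend xE.
- by apply: enc_inj; rewrite enc_pend encj xE xp /= pE iE.
- by apply: enc_inj; rewrite enc_pend encj enc_pend xE yp /= pE iE.
- apply: (enc_inj L' _ (inl _)); rewrite (enc_tmatch L'_gt0 V') /=.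
  by rewrite pE qE iE.
- apply: (enc_inj L' _ (inl _)); rewrite (enc_tmatch L'_gt0 V') /=.
  by rewrite pE qE iE.
- apply: (enc_inj L' _ (inl _)); rewrite (enc_tmatch L'_gt0 V') /=.
  by rewrite qE !iE.
Qed.

End Runs.

(** * Certificates *)

(* The certificates were found by a breadth-first search through patches with
   at most six tetrahedra. *)

(* An entry [(z, w, ms)] moves the snake [nsnake1 z] to [nsnake1 w], where
   [npatch1] is a single tetrahedron; the snakes 0, ..., 3 are on the germs glued
   to its faces, and the snakes 4, ..., 7 on the faces themselves. *)
Definition travel_certificates : seq (nat * nat * seq move) := [::
  (4, 0,
   [:: Move true 0 2 [:: 1; 1; 0; 0; 2] [:: (2, 3)];
      Move false 2 3 [:: 3; 1; 2; 1; 2] [:: (0, 0)];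
      Move true 2 3 [:: 3; 1; 1; 2; 2] [:: (0, 0)];
      Move false 0 3 [:: 1; 1; 0; 0; 2] [:: (3, 2)]]);
  (0, 3,
   [:: Move true 0 3 [:: 1; 1; 0; 0; 2] [:: (2, 3)];
      Move false 2 3 [:: 3; 1; 1; 2; 2] [:: (0, 0)];
      Move true 1 2 [:: 0; 1; 0; 2; 3] [:: (2, 1)];
      Move false 2 4 [:: 0; 1; 0; 2; 1] [:: (3, 2)]]);
  (0, 7,
   [:: Move true 0 3 [:: 1; 1; 0; 0; 2] [:: (2, 3)];
      Move false 2 3 [:: 3; 1; 1; 2; 2] [:: (0, 0)];
      Move true 1 2 [:: 0; 0; 1; 2; 3] [:: (2, 1)];
      Move false 1 4 [:: 0; 0; 1; 2; 1] [:: (3, 2)]]);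
  (0, 5,
   [:: Move true 0 3 [:: 1; 1; 0; 0; 2] [:: (2, 3)];
      Move true 1 2 [:: 0; 0; 1; 2; 3] [:: (2, 4); (3, 1)];
      Move true 0 4 [:: 1; 1; 4; 5; 4] [:: (0, 0); (2, 2); (3, 3)];
      Move false 0 3 [:: 1; 4; 1; 4; 3] [:: (0, 0); (2, 2); (5, 3)];
      Move false 2 4 [:: 1; 3; 1; 4; 3] [:: (0, 0); (2, 2)];
      Move false 1 2 [:: 0; 0; 1; 2; 3] [:: (1, 2)]]);
  (5, 1,
   [:: Move true 1 2 [:: 0; 1; 0; 2; 3] [:: (2, 1)];
      Move false 2 3 [:: 0; 1; 0; 1; 3] [:: (2, 2)];
      Move true 2 3 [:: 0; 1; 1; 0; 3] [:: (2, 2)];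
      Move false 1 3 [:: 0; 1; 2; 0; 3] [:: (1, 2)]]);
  (1, 2,
   [:: Move true 1 3 [:: 0; 1; 2; 0; 3] [:: (2, 1)];
      Move false 2 3 [:: 0; 1; 1; 0; 3] [:: (2, 2)];
      Move true 1 2 [:: 0; 1; 0; 2; 3] [:: (2, 1)];
      Move false 2 3 [:: 0; 1; 0; 1; 3] [:: (2, 2)]]);
  (1, 6,
   [:: Move true 1 3 [:: 0; 1; 2; 0; 3] [:: (2, 1)];
      Move false 2 3 [:: 0; 1; 1; 0; 3] [:: (2, 2)];
      Move true 1 2 [:: 0; 0; 1; 2; 3] [:: (2, 1)];
      Move false 1 3 [:: 0; 0; 1; 1; 3] [:: (2, 2)]])]%N.

(* An entry [(i, j, ms)] creates a snake in [npatch2 i j], which consists of two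
   tetrahedra, the face [i] of the first one being glued to the face [j] of the
   second one. *)
Definition birth_certificates : seq (nat * nat * seq move) := [::
  (0, 1,
   [:: Move true 0 2 [:: 1; 0; 0; 1; 2] [::];
      Move true 1 3 [:: 1; 0; 0; 1; 2] [:: (2, 3)];
      Move true 0 4 [:: 1; 2; 1; 3; 2] [:: (0, 0); (3, 4)];
      Move false 0 2 [:: 3; 2; 2; 3; 4] [:: (0, 0); (1, 1)];
      Move true 2 3 [:: 1; 3; 1; 2; 2] [:: (0, 0); (3, 4)];
      Move false 1 3 [:: 1; 2; 0; 0; 2] [:: (3, 3); (4, 1)]]);
  (0, 2,
   [:: Move true 0 3 [:: 1; 0; 1; 0; 2] [::];
      Move true 1 2 [:: 1; 0; 1; 0; 2] [:: (2, 3)];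
      Move true 0 4 [:: 1; 2; 3; 1; 2] [:: (0, 0); (3, 4)];
      Move false 0 3 [:: 3; 2; 3; 2; 4] [:: (0, 0); (1, 1)];
      Move true 2 3 [:: 1; 3; 1; 2; 2] [:: (0, 0); (3, 4)];
      Move false 1 3 [:: 1; 2; 0; 0; 2] [:: (3, 3); (4, 1)]]);
  (0, 3,
   [:: Move true 0 4 [:: 1; 0; 1; 2; 0] [::];
      Move true 1 2 [:: 1; 0; 1; 2; 0] [:: (2, 3)];
      Move true 0 3 [:: 1; 2; 3; 2; 1] [:: (0, 0); (3, 4)];
      Move false 0 4 [:: 3; 2; 3; 4; 2] [:: (0, 0); (1, 1)];
      Move true 2 3 [:: 1; 3; 1; 2; 2] [:: (0, 0); (3, 4)];
      Move false 1 3 [:: 1; 2; 0; 0; 2] [:: (3, 3); (4, 1)]]);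
  (1, 1,
   [:: Move true 1 2 [:: 0; 0; 1; 1; 2] [::];
      Move true 0 3 [:: 0; 0; 1; 1; 2] [:: (2, 3)];
      Move true 2 4 [:: 2; 1; 1; 3; 2] [:: (0, 0); (3, 4)];
      Move false 1 2 [:: 2; 2; 3; 3; 4] [:: (0, 0); (1, 1)];
      Move true 2 3 [:: 3; 1; 1; 2; 2] [:: (0, 0); (3, 4)];
      Move false 0 3 [:: 2; 1; 0; 0; 2] [:: (3, 3); (4, 1)]]);
  (1, 2,
   [:: Move true 1 3 [:: 0; 1; 1; 0; 2] [::];
      Move true 0 2 [:: 0; 1; 1; 0; 2] [:: (2, 3)];
      Move true 1 4 [:: 2; 1; 3; 1; 2] [:: (0, 0); (3, 4)];
      Move false 1 3 [:: 2; 3; 3; 2; 4] [:: (0, 0); (1, 1)];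
      Move true 2 3 [:: 3; 1; 1; 2; 2] [:: (0, 0); (3, 4)];
      Move false 0 3 [:: 2; 1; 0; 0; 2] [:: (3, 3); (4, 1)]]);
  (1, 3,
   [:: Move true 1 4 [:: 0; 1; 1; 2; 0] [::];
      Move true 0 2 [:: 0; 1; 1; 2; 0] [:: (2, 3)];
      Move true 1 3 [:: 2; 1; 3; 2; 1] [:: (0, 0); (3, 4)];
      Move false 1 4 [:: 2; 3; 3; 4; 2] [:: (0, 0); (1, 1)];
      Move true 2 3 [:: 3; 1; 1; 2; 2] [:: (0, 0); (3, 4)];
      Move false 0 3 [:: 2; 1; 0; 0; 2] [:: (3, 3); (4, 1)]]);
  (2, 2,
   [:: Move true 2 3 [:: 0; 1; 0; 1; 2] [::];
      Move true 1 4 [:: 1; 1; 2; 3; 2] [:: (0, 0)];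
      Move true 0 3 [:: 1; 1; 3; 3; 2] [:: (0, 0); (2, 4)];
      Move false 2 3 [:: 0; 1; 0; 2; 2] [:: (3, 1); (4, 3)];
      Move true 2 3 [:: 4; 1; 1; 3; 3] [:: (0, 0); (2, 2)];
      Move false 0 3 [:: 2; 1; 0; 0; 3] [:: (2, 1); (4, 3)]]);
  (2, 3,
   [:: Move true 2 4 [:: 0; 1; 1; 2; 0] [::];
      Move true 1 3 [:: 1; 1; 2; 2; 3] [:: (0, 0)];
      Move true 0 2 [:: 1; 1; 2; 2; 3] [:: (0, 0); (3, 4)];
      Move false 2 4 [:: 0; 1; 2; 2; 0] [:: (3, 1); (4, 3)];
      Move true 2 3 [:: 4; 1; 1; 3; 3] [:: (0, 0); (2, 2)];
      Move false 0 3 [:: 2; 1; 0; 0; 3] [:: (2, 1); (4, 3)]])]%N.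


(** The face [i] of the single positive tetrahedron has number [code 3 0 i], that is [4 + i], and is
    attached to the label [i]; [signs1] lists the signs of these faces. *)
Definition npatch1 : npatch := ([:: true], [:: 4; 5; 6; 7; 0; 1; 2; 3]%N).
Definition signs1 : seq bool := [:: true; false; true; false].
Definition nsnake1 : nat -> npatch := nsnake 3 signs1 npatch1.

Definition other_faces (i : nat) : seq nat := [seq k <- iota 0 4 | k != i].

(** The first tetrahedron is positive; the sign of the second is forced by the opposite signs of the
    two glued faces. Labels 0 to 2 are the free faces of the first tetrahedron, labels 3 to 5 those
    of the second. *)
Definition npatch2 (i j : nat) : npatch :=
  ([:: true; odd i (+) odd j],
   [seq code 5 0 k | k <- other_faces i] ++
   [seq code 5 1 k | k <- other_faces j] ++
   [seq if k == i then code 5 1 j else index k (other_faces i) | k <- iota 0 4]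
   ++
   [seq if k == j then code 5 0 i else 3 + index k (other_faces j)
   | k <- iota 0 4])%N.
Definition signs2 (i j : nat) : seq bool :=
  [seq ~~ odd k | k <- other_faces i] ++
  [seq odd i (+) odd j (+) odd k | k <- other_faces j].
Definition nsnake2 (i j : nat) : npatch :=
  nsnake 5 (signs2 i j) (npatch2 i j) 0%N.

(** These are the pairs [(a, c.-1)] for the apexes [a < c] of the eight sliding moves. *)
Definition sliding_types : seq (nat * nat) :=
  [seq p <- [seq (i, j) | i <- iota 0 4, j <- iota 0 4]
  | (p.1 <= p.2)%N && (p \notin [:: (0, 0)%N; (3, 3)%N])].

Lemma travel_check : all (fun c =>
    nrun 3 signs1 (nsnake1 c.1.1) c.2 == Some (nsnake1 c.1.2))
  travel_certificates.
Proof. by vm_compute. Qed.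

Lemma npatch1_valid : nvalid 3 signs1 npatch1.
Proof. by vm_compute. Qed.

Lemma nsnake1_valid : all (fun x => nvalid 3 signs1 (nsnake1 x) &&
  nsnake_ok 3 npatch1 (nsnake1 x) x) (iota 0 8).
Proof. by vm_compute. Qed.

Lemma birth_check : all (fun p =>
  has (fun c => [&& c.1 == p, (if c.2 is m :: _ then mv_pos m else false) &
    nrun 5 (signs2 p.1 p.2) (npatch2 p.1 p.2) c.2 == Some (nsnake2 p.1 p.2)])
  birth_certificates) sliding_types.
Proof. by vm_compute. Qed.

Lemma npatch2_valid : all (fun p => [&&
  nvalid 5 (signs2 p.1 p.2) (npatch2 p.1 p.2),
  nvalid 5 (signs2 p.1 p.2) (nsnake2 p.1 p.2),
  nsnake_ok 5 (npatch2 p.1 p.2) (nsnake2 p.1 p.2) 0 &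
  all (fun z => (nmatch (npatch2 p.1 p.2) z <= 5)%N ||
    ((z, nmatch (npatch2 p.1 p.2) z) \in
      [:: (code 5 0 p.1, code 5 1 p.2); (code 5 1 p.2, code 5 0 p.1)]))
    (iota 6 8)]) sliding_types.
Proof. by vm_compute. Qed.

(** * Moving a snake *)

Local Notation sliding_related := (related positive_sliding_move).

Lemma sliding_refl P : sliding_related P P.
Proof. exact: rst_refl. Qed.

Lemma sliding_sym P Q : sliding_related P Q -> sliding_related Q P.
Proof. exact: rst_sym. Qed.

Lemma sliding_trans P Q S :
  sliding_related P Q -> sliding_related Q S -> sliding_related P S.
Proof. exact: rst_trans. Qed.

Lemma iso_sliding P Q : spine_iso P Q -> sliding_related P Q.
Proof. by move=> PQ; apply: rst_step; left. Qed.

Lemma snake_on_iso (P P' Q : spine) (f : tet P -> tet P') (x : face P) :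
    bijective f -> (forall t, sgn (f t) = sgn t) ->
    (forall z, pairing (face_map f z) = face_map f (pairing z)) ->
  snake_on Q x -> snake_on Q (face_map f x).
Proof.
case=> g fK gK fS fP [h [hB hS hP hpq]].
pose gh (t : tet P' + bool) := match t with inl t => inl (g t) | inr b => inr b end.
have ghB : bijective gh.
  exists (fun t => match t with inl t => inl (f t) | inr b => inr b end).
    by case=> //= t; rewrite gK.
  by case=> //= t; rewrite fK.
have fg z : face_map f (g z.1, z.2) = z.
  by case: z => t i; rewrite /face_map /= gK.
have gf z : (g (face_map f z).1, (face_map f z).2) = z.
  by case: z => t i; rewrite /face_map /= fK.
have gP z : pairing (g z.1, z.2) = (g (pairing z).1, (pairing z).2).
  by rewrite -{3 4}(fg z) fP gf.
exists (h \o gh); split.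
- exact: bij_comp.
- by move=> t; rewrite hS -{2}[t]gK fS.
- move=> z zx zy; have := hP (g z.1, z.2); rewrite gP; apply.
    by move=> xE; apply: zx; rewrite -xE fg.
  by move=> yE; apply: zy; rewrite fP -yE fg.
- by rewrite fP /= !fK.
Qed.

Lemma snake_on_unique_face (P Q Q' : spine) (x : face P) :
    ordered P -> ordered Q -> ordered Q' -> snake_on Q x -> snake_on Q' x ->
  spine_iso Q Q'.
Proof.
have face_map_id y : @face_map P P id y = y by case: y.
move=> oP oQ oQ' Qx Q'x; apply: (@snake_on_unique P P Q Q' id x) => //.
- by exists id.
- by rewrite face_map_id.
Qed.

Section Travel.

Variables (b : bool) (C : context (@tos 3 signs1 b)).

Let V x : (x < 8)%N -> nvalid 3 signs1 (nsnake1 x).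
Proof.
move=> lt_x8; have /allP/(_ x) := nsnake1_valid.
by rewrite mem_iota => /(_ lt_x8)/andP[].
Qed.

(** The certificates are the edges of a tree with root 4: it leads to 0, then 0 to 3, 7 and 5, then
    5 to 1, and 1 to 2 and 6. *)
Lemma travel x (V4 : nvalid 3 signs1 (nsnake1 4)%N)
    (Vx : nvalid 3 signs1 (nsnake1 x)) : (x < 8)%N ->
  sliding_related (cspine C (vpatch b V4)) (cspine C (vpatch b Vx)).
Proof.
have step i : (i < 7)%N ->
    let c := nth (0, 0, [::])%N travel_certificates i in
    forall (Vz : nvalid 3 signs1 (nsnake1 c.1.1))
           (Vw : nvalid 3 signs1 (nsnake1 c.1.2)),
    sliding_related (cspine C (vpatch b Vz)) (cspine C (vpatch b Vw)).
  move=> lt_i7 c Vz Vw; apply: nrun_sound.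
  exact/eqP/(all_nthP (0, 0, [::])%N travel_check).
have V_ k (lt_k : (k < 8)%N) := V lt_k.
have r0 (V0 : nvalid 3 signs1 (nsnake1 0%N)) := step 0%N isT V4 V0.
have r3 (V3 : nvalid 3 signs1 (nsnake1 3%N)) :=
  sliding_trans (r0 (V_ 0%N isT)) (step 1%N isT (V_ 0%N isT) V3).
have r7 (V7 : nvalid 3 signs1 (nsnake1 7%N)) :=
  sliding_trans (r0 (V_ 0%N isT)) (step 2%N isT (V_ 0%N isT) V7).
have r5 (V5 : nvalid 3 signs1 (nsnake1 5%N)) :=
  sliding_trans (r0 (V_ 0%N isT)) (step 3%N isT (V_ 0%N isT) V5).
have r1 (V1 : nvalid 3 signs1 (nsnake1 1%N)) :=
  sliding_trans (r5 (V_ 5%N isT)) (step 4%N isT (V_ 5%N isT) V1).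
have r2 (V2 : nvalid 3 signs1 (nsnake1 2%N)) :=
  sliding_trans (r1 (V_ 1%N isT)) (step 5%N isT (V_ 1%N isT) V2).
have r6 (V6 : nvalid 3 signs1 (nsnake1 6%N)) :=
  sliding_trans (r1 (V_ 1%N isT)) (step 6%N isT (V_ 1%N isT) V6).
case: x Vx => [|[|[|[|[|[|[|[|x]]]]]]]] Vx // _; first [exact: r0 | exact: r1 |
  exact: r2 | exact: r3 | exact: r5 | exact: r6 | exact: r7 | idtac].
by rewrite (bool_irrelevance Vx V4); apply: sliding_refl.
Qed.

End Travel.

(** The eight germs at [t], numbered as in [npatch1]: [4 + i] is the face [i] of [t] and [i] is the
    face glued to it. The patch has no inner gluing, so it sits at any tetrahedron. *)
Lemma tet_snakes (P : spine) (t : tet P) : ordered P ->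
  exists S : 'I_8 -> spine,
    (forall k, ordered (S k) /\ sliding_related (S ord0) (S k)) /\
    (forall i : 'I_4, snake_on (S (inord (4 + i))) (t, i) /\
                      snake_on (S (inord i)) (pairing (t, i))).
Proof.
(* The patch is positive, so [b] takes its mirror image exactly when [t] is negative. *)
move=> oP; pose b := ~~ sgn t; pose L := vpatch b npatch1_valid.
have L1 (x y : ptet L * 'I_4) : pmatch x <> inl y.
  move=> /= E; have := enc_tmatch (nvalid_gt0 npatch1_valid) npatch1_valid (inl x).
  rewrite E; case: x {E} => [u i] /=.
  have -> : u = ord0 by apply: val_inj; case: u => [[|[]]].
  by case: (ord4P i) => ->; rewrite inordK // /code /=; lia.
have [|||C [f [fB fS fP ft]]] := @extract_patch _ _ L P (fun=> t) oP.
- by move=> [[|k] lt_k] [[|k'] lt_k'] //= _; apply: val_inj.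
- by move=> [[|k] lt_k] //=; rewrite /tsgn /b /= addbT negbK.
- by move=> x y /L1.
have V (k : 'I_8) : nvalid 3 signs1 (nsnake1 k) /\ nsnake_ok 3 npatch1 (nsnake1 k) k.
  have /allP/(_ (k : nat)) := nsnake1_valid.
  by rewrite mem_iota ltn_ord => /(_ isT)/andP[].
exists (fun k => cspine C (vpatch b (proj1 (V k)))); split=> [k|i].
  split=> //; have V4 : nvalid 3 signs1 (nsnake1 4%N).
    exact: (proj1 (V (Ordinal (isT : 4 < 8)%N))).
  by apply: sliding_trans (travel C V4 _ _) => //; apply/sliding_sym/travel.
have snk k := snake_on_iso fB fS fP
  (nsnake_sound npatch1_valid (proj1 (V k)) C (proj2 (V k))).
have dec_i : dec 3 npatch1 (4 + i) = inl (ord0, i).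
  by rewrite -(encK (inl (ord0, i))).
have face_i : face_map f (@end_face _ _ C L (dec 3 npatch1 (4 + i))) = (t, i).
  by rewrite dec_i /face_map /= ft.
have pend_i : @pend _ _ L (dec 3 npatch1 (4 + i)) = dec 3 npatch1 i.
  rewrite dec_i; apply: (congr1 (dec 3 npatch1)).
  by case: (ord4P i) => ->; rewrite /= inordK.
have i4 : (4 + i < 8)%N by have := ltn_ord i; lia.
have i8 : (i < 8)%N by have := ltn_ord i; lia.
split.
  have := snk (inord (4 + i)); rewrite -face_i.
  by rewrite [X in dec _ _ X]inordK.
have := snk (inord i); rewrite -face_i fP pairing_end_face pend_i.
by rewrite [X in dec _ _ X]inordK.
Qed.

Lemma snake_exists (P : spine) (x : face P) : ordered P ->
  exists Q, ordered Q /\ snake_on Q x.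
Proof.
case: x => t i oP; have [S [oS snkS]] := tet_snakes t oP.
by exists (S (inord (4 + i))); split; [case: (oS (inord (4 + i)))|case: (snkS i)].
Qed.

(** Two snakes whose edges touch a common tetrahedron are related by [tet_snakes]. The tetrahedra
    all of whose snakes are related to [Q] are thus closed under adjacency, and the spine is
    connected. *)
Lemma snakes_related (P Q Q' : spine) (x x' : face P) :
    ordered P -> ordered Q -> ordered Q' -> snake_on Q x -> snake_on Q' x' ->
  sliding_related Q Q'.
Proof.
move=> oP oQ oQ' Qx.
have near_tet (R R' : spine) (t : tet P) (y y' : face P) :
    ordered R -> ordered R' -> snake_on R y -> snake_on R' y' ->
    (y.1 = t \/ (pairing y).1 = t) -> (y'.1 = t \/ (pairing y').1 = t) ->
    sliding_related R R'.
  have [S [oS snkS]] := tet_snakes t oP.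
  have to_S (R1 : spine) (z : face P) : ordered R1 -> snake_on R1 z ->
      z.1 = t \/ (pairing z).1 = t -> sliding_related (S ord0) R1.
    move=> oR1 R1z zt.
    have [k Sk] : exists k, snake_on (S k) z.
      case: zt => zt; [exists (inord (4 + z.2))|exists (inord (pairing z).2)].
        by case: (snkS z.2) => + _; rewrite -zt -surjective_pairing.
      by case: (snkS (pairing z).2) => _; rewrite -zt -surjective_pairing pairingK.
    have [oSk relk] := oS k; apply: sliding_trans relk (iso_sliding _).
    exact: snake_on_unique_face Sk R1z.
  move=> oR oR' Ry R'y' yt y't.
  exact: sliding_trans (sliding_sym (to_S _ _ oR Ry yt)) (to_S _ _ oR' R'y' y't).
pose g (u : tet P) := `[< forall (R : spine) (y : face P), y.1 = u ->
  ordered R -> snake_on R y -> sliding_related Q R >].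
have g_step (y : face P) : g y.1 -> g (pairing y).1.
  move/asboolP=> gy; apply/asboolP => R y' y'E oR Ry'.
  have [R1 [oR1 R1y]] := snake_exists (pairing y) oP.
  have [R2 [oR2 R2y]] := snake_exists y oP.
  apply: sliding_trans (gy _ _ erefl oR2 R2y) _.
  apply: (sliding_trans (Q := R1)).
    by apply: (near_tet _ _ y.1 _ _ oR2 oR1 R2y R1y); [left|right; rewrite pairingK].
  by apply: (near_tet _ _ (pairing y).1 _ _ oR1 oR R1y Ry'); left.
have gx : g x.1.
  apply/asboolP => R y yx oR Ry.
  by apply: (near_tet _ _ x.1 _ _ oQ oR Qx Ry); left.
move=> Q'x'; have : g x'.1; last by move/asboolP/(_ _ _ erefl); apply.
rewrite -(gluing_connected (ordered_gluing oP) (g := g) _ x.1) // => y.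
by apply/idP/idP => [/g_step|/g_step //]; rewrite pairingK.
Qed.

(** The gluings where a positive sliding move starts. For apexes [a < c], the common triangle is the
    face [a] of [D_c] and the face [c.-1] of [D_a]; labels [(0, 0)] thus mean apexes 0, 1 and labels
    [(3, 3)] apexes 3, 4, the two cases that do not slide. *)
Definition slidable_face (P : spine) (x : face P) : Prop :=
  [/\ x.1 <> (pairing x).1,
      (x.2 : nat, (pairing x).2 : nat) <> (0, 0)%N &
      (x.2 : nat, (pairing x).2 : nat) <> (3, 3)%N].

Definition slidable (P : spine) : Prop := exists x : face P, slidable_face x.

(** The germ [x] is now glued to the face 1 of a new tetrahedron, and a gluing with a label 1 is
    neither of type [(0, 0)] nor [(3, 3)]. *)
Lemma snake_slidable (P Q : spine) (x : face P) : snake_on Q x -> slidable Q.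
Proof.
case=> h [hB _ _ [xp _ _ _ _]]; exists (h (inl x.1), x.2); rewrite /slidable_face xp.
split=> /=; first by move/(bij_inj hB).
  by case=> _; rewrite inordK.
by case=> _; rewrite inordK.
Qed.

Lemma code_inj n t t' (i i' : 'I_4) : code n t i = code n t' i' -> t = t' /\ i = i'.
Proof.
move=> E; split; first by rewrite -(code_tetK n t i) E code_tetK.
by apply: val_inj; rewrite /= -(code_idxK n t i) E code_idxK.
Qed.

(** Exchanging the two sides of the gluing puts the smaller label first. Further gluings between the
    two tetrahedra are left to the context. *)
Lemma slidable_patch (P : spine) : ordered P -> slidable P ->
  exists i j : nat, (i, j) \in sliding_types /\
  forall V : nvalid 5 (signs2 i j) (npatch2 i j),
  exists b (C : context (@tos 5 (signs2 i j) b))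
         (f : tet (cspine C (vpatch b V)) -> tet P),
  [/\ bijective f, forall t, sgn (f t) = sgn t &
      forall x, pairing (face_map f x) = face_map f (pairing x)].
Proof.
move=> oP; case=> x0 x0S.
have [x [xS le_x]] : exists x : face P,
    slidable_face x /\ (x.2 <= (pairing x).2)%N.
  case: (leqP x0.2 (pairing x0).2) => [le_x|lt_x]; first by exists x0.
  exists (pairing x0); rewrite pairingK (ltnW lt_x); split=> //.
  case: x0S => n1 n2 n3; rewrite /slidable_face pairingK.
  split; [exact: nesym| |]; by move=> [E E']; rewrite E E' in n2 n3.
case: xS => x_neq x00 x33; set y := pairing x.
have xyT : (val x.2, val y.2) \in sliding_types.
  rewrite mem_filter; apply/andP; split; last first.
    by apply/allpairsP; exists (val x.2, val y.2); rewrite !mem_iota !ltn_ord.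
  by apply/andP; split=> //; rewrite !inE negb_or; apply/andP; split; apply/eqP.
exists x.2, y.2; split=> // V; pose b := ~~ sgn x.1; pose L := vpatch b V.
pose phi (u : ptet L) := if u == ord0 then x.1 else y.1.
have phi0 (u : ptet L) : u = 0%N :> nat -> phi u = x.1.
  by move=> u0; rewrite /phi -val_eqE /= u0.
have phi1 (u : ptet L) : u = 1%N :> nat -> phi u = y.1.
  by move=> u0; rewrite /phi -val_eqE /= u0.
have tetP (u : ptet L) : u = 0%N :> nat \/ u = 1%N :> nat.
  by case: u => [[|[|k]] lt_k]; [left|right|].
have ySgn : sgn y.1 = ~~ (sgn x.1 (+) odd x.2) (+) odd y.2.
  have := gluing_sgn (ordered_gluing oP) x; rewrite /face_sgn -/y.
  by move: (sgn y.1) (sgn x.1) (odd x.2) (odd y.2) => [] [] [] [].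
have phi_pairing (u v : ptet L * 'I_4) : pmatch u = inl v ->
    pairing (phi u.1, u.2) = (phi v.1, v.2).
  move=> /= E; have := enc_tmatch (nvalid_gt0 V) V (inl u); rewrite E.
  have /allP/(_ _ xyT)/and4P[_ _ _ /allP matchP] := npatch2_valid.
  have : enc (n := 5) (inl u) \in iota 6 8.
    by rewrite mem_iota leq_code; apply: (enc_lt (nvalid_gt0 V) (inl u)).
  move/matchP => + uv; rewrite -uv.
  rewrite leqNgt leq_code /= !inE !xpair_eqE.
  case/orP=> /andP[/eqP/code_inj[u1 u2] /eqP/code_inj[v1 v2]].
    rewrite (phi0 u.1) // (phi1 v.1) // u2 v2 -surjective_pairing.
    by rewrite /y -surjective_pairing.
  rewrite (phi1 u.1) // (phi0 v.1) // u2 v2 -!surjective_pairing.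
  by rewrite /y pairingK.
have [|||C [f [fB fS fP _]]] := @extract_patch _ _ L P phi oP.
- move=> u v; have [u0|u1] := tetP u; have [v0|v1] := tetP v.
  + by move=> _; apply: ord_inj; rewrite u0 v0.
  + by rewrite phi0 // phi1.
  + by rewrite phi1 // phi0 // => /nesym.
  + by move=> _; apply: ord_inj; rewrite u1 v1.
- move=> u; rewrite /= /tsgn; have [u0|u1] := tetP u.
    by rewrite phi0 // u0 /= addbT negbK.
  rewrite phi1 // u1 /= ySgn /b.
  by move: (sgn x.1) (odd x.2) (odd y.2) => [] [] [].
- exact: phi_pairing.
by exists b, C, f.
Qed.

(** * Sliding moves create snakes *)

Lemma up_to_iso_l m (P P' Q : spine) :
  spine_iso P P' -> up_to_iso m P' Q -> up_to_iso m P Q.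
Proof.
move=> PP' [P0 [Q0 [P'P0 oP0 PQ0 oQ0 Q0Q]]].
by exists P0, Q0; split=> //; apply: spine_iso_trans P'P0.
Qed.

(** The certificate for the type of the gluing begins with a positive move, which gives the first
    half, and ends with a snake, which gives the second. *)
Lemma slidable_birth (P : spine) : ordered P -> slidable P ->
  (exists Q, positive_sliding_move P Q) /\
  (exists Q (x : face P), [/\ ordered Q, snake_on Q x & sliding_related P Q]).
Proof.
move=> oP /(slidable_patch oP)[i [j [ijT]]].
have [V V' ok] : [/\ nvalid 5 (signs2 i j) (npatch2 i j),
    nvalid 5 (signs2 i j) (nsnake2 i j) &
    nsnake_ok 5 (npatch2 i j) (nsnake2 i j) 0].
  by have /allP/(_ _ ijT)/and4P[] := npatch2_valid.
move/(_ V)=> [b [C [f [fB fS fP]]]].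
have P'P : spine_iso (cspine C (vpatch b V)) P by apply: (@ordered_iso _ _ f).
have /allP/(_ _ ijT)/(nth_find (0, 0, [::])%N) := birth_check.
move: (nth _ _ _) => [p [|[pos a c D ren] ms]] /and3P[_ posT /eqP run] //.
have {posT} posE : pos = true by [].
have {}run : nrun 5 (signs2 i j) (npatch2 i j) (Move true a c D ren :: ms) =
  Some (nsnake2 i j) by rewrite -posE.
split.
  have [Q P'Q] := nrun_positive V C run.
  by exists Q; apply: up_to_iso_l P'Q; apply: spine_iso_sym.
exists (cspine C (vpatch b V')).
have snk := nsnake_sound V V' C ok.
eexists; split=> //; first exact: snake_on_iso fB fS fP snk.
apply: sliding_trans (iso_sliding (spine_iso_sym P'P)) _.
exact: nrun_sound run.
Qed.

(** For distinct vertices, the sum is 1 only for 0, 1 and 7 only for 3, 4. *)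
Lemma opposite_slidable (k l : 'I_5) : k != l -> (k + l != 1)%N ->
    (k + l != 7)%N ->
  (opposite k l : nat, opposite l k : nat) <> (0, 0)%N /\
  (opposite k l : nat, opposite l k : nat) <> (3, 3)%N.
Proof.
move=> kl n1 n7; have lk : l != k by rewrite eq_sym.
rewrite (val_opposite kl) (val_opposite lk) /opp {lk}.
have := ltn_ord k; have := ltn_ord l; move: kl n1 n7; rewrite -val_eqE /=.
move: (k : nat) (l : nat) => {}k {}l.
move=> kl n1 n7 l5 k5; case: (ltnP l k) => lk; case: (ltnP k l) => kl'.
all: by split; case; lia.
Qed.

(** The target of a sliding move also has a slidable gluing, among its three tetrahedra around the
    new edge. A spine to which a negative move applies thus admits a positive one, and rigidity is
    the absence of slidable gluings. *)
Lemma sliding_move_slidable (P Q : spine) : positive_sliding_move P Q ->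
  (exists P0, [/\ spine_iso P P0, ordered P0 & slidable P0]) /\
  (exists Q0, [/\ spine_iso Q Q0, ordered Q0 & slidable Q0]).
Proof.
case=> P0 [Q0 [PP0 oP0 [A [A2 A01 A34 [E [h [h' [eps mp]]]]]] oQ0 Q0Q]].
case: mp => -[hB h'B] _ inP inQ _; split; [exists P0|exists Q0]; split=> //.
- have /eqP/cards2P[a [c [ac AE]]] := A2.
  have aA : a \in A by rewrite AE !inE eqxx.
  have cA : c \in A by rewrite AE !inE eqxx orbT.
  pose a' : {k | k \in A} := exist (fun k => k \in A) a aA.
  pose c' : {k | k \in A} := exist (fun k => k \in A) c cA.
  have [||n0 n3] := @opposite_slidable a c ac.
  + apply: contraNneq A01 => ac1; rewrite AE; apply/eqP/setP => k.
    move: ac; rewrite !inE -!val_eqE /=; lia.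
  + apply: contraNneq A34 => ac1; rewrite AE; apply/eqP/setP => k.
    have := ltn_ord a; have := ltn_ord c; have := ltn_ord k.
    move: ac; rewrite !inE -!val_eqE /=; lia.
  exists (h (inr a'), opposite a c); rewrite /slidable_face (inP a' c' ac).
  split=> //= /(bij_inj hB)[] /(congr1 val) /= acE.
  by rewrite -val_eqE /= acE eqxx in ac.
- exact: spine_iso_sym.
- have : (2 < #|~: A|)%N by rewrite cardsCs finset.setCK card_ord A2.
  case/card_gt2P => a [c [d [[]]]]; rewrite !inE => aA cA dA [ac cd da].
  (* The pairs 0, 1 and 3, 4 are disjoint, so at most one of the three pairs taken from [a], [c],
     [d] is excluded. *)
  have [k [l [kA lA kl [n1 n7]]]] : exists k l : 'I_5,
      [/\ k \notin A, l \notin A, k != l & (k + l != 1)%N /\ (k + l != 7)%N].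
    have := ltn_ord a; have := ltn_ord c; have := ltn_ord d => d5 c5 a5.
    have [acP|] := boolP ((a + c != 1)%N && (a + c != 7)%N).
      by exists a, c; split=> //; apply/andP.
    have [cdP|] := boolP ((c + d != 1)%N && (c + d != 7)%N).
      by exists c, d; split=> //; apply/andP.
    move=> cdN acN; exists d, a; split=> //.
    by move: ac cd da cdN acN; rewrite -!val_eqE /=; lia.
  pose k' : {k | k \notin A} := exist (fun k => k \notin A) k kA.
  pose l' : {k | k \notin A} := exist (fun k => k \notin A) l lA.
  have [n0 n3] := opposite_slidable kl n1 n7.
  exists (h' (inr k'), opposite k l); rewrite /slidable_face (inQ k' l' kl).
  split=> //= /(bij_inj h'B)[] /(congr1 val) /= klE.
  by rewrite -val_eqE /= klE eqxx in kl.
Qed.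

Lemma nonrigid_slidable (P : spine) : ~ rigid P ->
  exists P0, [/\ spine_iso P P0, ordered P0 & slidable P0].
Proof.
move=> nP; apply/not_existsP => nP0; apply: nP => Q; split.
  by move/sliding_move_slidable => [[P0 P0P] _]; apply: nP0 P0P.
by move/sliding_move_slidable => [_ [P0 P0P]]; apply: nP0 P0P.
Qed.

Lemma snake_moveP (P Q : spine) : snake_move P Q <->
  exists P0 Q0 (x : face P0),
    [/\ spine_iso P P0, ordered P0, snake_on Q0 x, ordered Q0 & spine_iso Q0 Q].
Proof.
split=> [[P0 [Q0 [PP0 oP0 /snake_atP[x snk] oQ0 Q0Q]]]|]; first by exists P0, Q0, x.
case=> P0 [Q0 [x [PP0 oP0 snk oQ0 Q0Q]]]; exists P0, Q0; split=> //.
by apply/snake_atP; exists x.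
Qed.

Lemma snake_moves_related (P P' Q Q' : spine) : spine_iso P P' ->
  snake_move P Q -> snake_move P' Q' -> sliding_related Q Q'.
Proof.
move=> PP' /snake_moveP[P0 [Q0 [x [PP0 oP0 snk oQ0 Q0Q]]]].
case/snake_moveP=> P0' [Q0' [x' [PP0' oP0' snk' oQ0' Q0Q']]].
have /(iso_ordered oP0 oP0')[f [fB fS fP]] : spine_iso P0 P0'.
  apply: spine_iso_trans (spine_iso_sym PP0) _.
  exact: spine_iso_trans PP' PP0'.
have := snakes_related oP0' oQ0 oQ0' (snake_on_iso fB fS fP snk) snk'.
move=> QQ'; apply: sliding_trans (iso_sliding (spine_iso_sym Q0Q)) _.
exact: sliding_trans QQ' (iso_sliding Q0Q').
Qed.

Lemma snake_move_exists (P : spine) : exists Q, snake_move P Q.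
Proof.
have [P0 [PP0 oP0]] := ordered_spine P.
have [t0 _] : exists t0 : tet P0, t0 \in predT by apply/card_gt0P/spine_nonempty.
have [Q0 [oQ0 snk]] := snake_exists (t0, ord0) oP0.
exists Q0; apply/snake_moveP; exists P0, Q0, (t0, ord0).
by split=> //; apply: spine_iso_refl.
Qed.

Lemma slidable_snake_related (P P0 Q : spine) : spine_iso P P0 ->
  ordered P0 -> slidable P0 -> snake_move P Q -> sliding_related P Q.
Proof.
move=> PP0 oP0 /(slidable_birth oP0)[_ [Q0 [x [oQ0 snk P0Q0]]]] PQ.
apply: sliding_trans (iso_sliding PP0) (sliding_trans P0Q0 _).
apply: (snake_moves_related (spine_iso_sym PP0)) PQ.
by apply/snake_moveP; exists P0, Q0, x; split=> //; apply: spine_iso_refl.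
Qed.

(** Snakes are slidable even when the spine carrying them is rigid, so they can follow the whole
    chain. Across a snake move from [P] to [Q], the spine [Q] is itself a snake on [P] and is
    related to its own snakes. *)
Lemma related_snakes (P Q : spine) :
    related (fun P' Q' => positive_sliding_move P' Q' \/ snake_move P' Q') P Q ->
  forall R S, snake_move P R -> snake_move Q S -> sliding_related R S.
Proof.
elim=> {P Q} [P Q [PQ|[PQ|PQ]]|P|P Q _ IH|P Q T _ IH1 _ IH2] R S PR QS.
- exact: snake_moves_related PQ PR QS.
- have [[P0 [PP0 oP0 sP0]] [Q0 [QQ0 oQ0 sQ0]]] := sliding_move_slidable PQ.
  apply: sliding_trans (sliding_sym (slidable_snake_related PP0 oP0 sP0 PR)) _.
  apply: sliding_trans (slidable_snake_related QQ0 oQ0 sQ0 QS).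
  by apply: rst_step; right.
- apply: sliding_trans (snake_moves_related (spine_iso_refl P) PR PQ) _.
  have [P0 [Q0 [x [_ _ snk oQ0 Q0Q]]]] := proj1 (snake_moveP _ _) PQ.
  by apply: slidable_snake_related (spine_iso_sym Q0Q) oQ0 (snake_slidable snk) QS.
- exact: snake_moves_related (spine_iso_refl P) PR QS.
- exact: sliding_sym (IH _ _ QS PR).
- have [U QU] := snake_move_exists Q.
  exact: sliding_trans (IH1 _ _ PR QU) (IH2 _ _ QU QS).
Qed.

Lemma nonrigid_sliding_related (P Q : spine) : ~ rigid P -> ~ rigid Q ->
    related (fun P' Q' => positive_sliding_move P' Q' \/ snake_move P' Q') P Q ->
  sliding_related P Q.
Proof.
move=> /nonrigid_slidable[P0 [PP0 oP0 sP0]] /nonrigid_slidable[Q0 [QQ0 oQ0 sQ0]].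
move=> PQ; have [R PR] := snake_move_exists P; have [S QS] := snake_move_exists Q.
apply: sliding_trans (slidable_snake_related PP0 oP0 sP0 PR) _.
apply: sliding_trans (related_snakes PQ PR QS) (sliding_sym _).
exact: slidable_snake_related QQ0 oQ0 sQ0 QS.
Qed.

(** * Boundary components *)

Section BoundaryTopology.

Import Order.TTheory GRing.Theory Num.Theory.
Local Open Scope classical_set_scope.
Local Open Scope ring_scope.

(** Identification of vertices of tetrahedra across a common face. The equivalence classes are the
    components of the boundary, whose tiles are the links of these vertices. *)
Definition vertex_step (P : spine) (a b : tet P * 'I_4) : Prop :=
  exists i, i != a.2 /\ b = ((glue a.1 i).1, (glue a.1 i).2 a.2).

Definition vertex_count (P : spine) (n : nat) : Prop :=
  exists k : tet P * 'I_4 -> 'I_n, (forall c, exists a, k a = c) /\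
    forall a b, k a = k b <-> clos_refl_sym_trans _ (@vertex_step P) a b.

Section LinkPath.

Variables (R : realType) (v : 'I_4).

(* The projection of the real line onto the unit interval. *)
Let clamp (s : R) : R := (`|s| - `|s - 1| + 1) / 2.

Let clamp0 : clamp 0 = 0.
Proof. by rewrite /clamp sub0r normrN normr0 normr1 sub0r addNr mul0r. Qed.

Let clamp1 : clamp 1 = 1.
Proof. by rewrite /clamp subrr normr0 normr1 subr0 divff. Qed.

Let clamp_itv s : 0 <= clamp s <= 1.
Proof.
by rewrite /clamp; case: (ger0P s) => s0; case: (ger0P (s - 1)) => s1; lra.
Qed.

Let clamp_continuous : continuous clamp.
Proof.
move=> s; apply: cvgM; last exact: cvg_cst.
apply: cvgD; last exact: cvg_cst.
apply: cvgB; first exact: norm_continuous.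
by apply: cvg_norm; apply: cvgB; [exact: cvg_id | exact: cvg_cst].
Qed.

(** The triangle is convex. The segment is prolonged to the whole line by [clamp], so that
    continuity is that of a function on the reals. *)
Lemma link_path (x y : set_type (@link_triangle R v)) :
  exists g : R -> set_type (@link_triangle R v),
    [/\ continuous g, g 0 = x & g 1 = y].
Proof.
pose g s : 'rV[R]_4 := \row_i ((1 - clamp s) * set_val x ord0 i +
                               clamp s * set_val y ord0 i).
have gP s : g s \in @link_triangle R v.
  have /andP[s0 s1] := clamp_itv s; have s1' : 0 <= 1 - clamp s by lra.
  have [xv x0 x1] := set_mem (valP x); have [yv y0 y1] := set_mem (valP y).
  apply/mem_set; split.
  - by rewrite mxE /set_val /= xv yv !mulr0 addr0.
  - by move=> i; rewrite mxE addr_ge0 // mulr_ge0 // ?x0 ?y0.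
  - under eq_bigr do rewrite mxE.
    by rewrite big_split /= -!mulr_sumr x1 y1 !mulr1 subrK.
exists (fun s => exist _ (g s) (gP s)); split.
- apply: continuous_comp_initial => s A [B nB BA] /=.
  (* A neighbourhood of a matrix consists of neighbourhoods of its entries, which are finite in
     number. *)
  have : \forall u \near s, forall i j, B i j (g u i j).
    have fil (I : finType) (f : I -> set R) : (forall i, nbhs s (f i)) ->
      \forall u \near s, forall i, f i u by exact: (filter_forall (nbhs_filter s)).
    apply: (fil _ (fun i u => forall j, B i j (g u i j))) => i.
    apply: (fil _ (fun j u => B i j (g u i j))) => j.
    suff gc : (fun u => g u i j) @ s --> g s i j by exact: gc (nB i j).
    rewrite ord1 /= mxE (_ : (fun u => g u 0 j) = (fun u => (1 - clamp u) *
      set_val x ord0 j + clamp u * set_val y ord0 j)); last first.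
      by apply/funext => u; rewrite mxE.
    apply: cvgD; apply: cvgM; [|exact: cvg_cst|exact: clamp_continuous|exact: cvg_cst].
    by apply: cvgB; [exact: cvg_cst|exact: clamp_continuous].
  by apply: filterS => u; apply: BA.
- apply: val_inj; apply/rowP => i; rewrite mxE clamp0 subr0 mul1r mul0r addr0.
  by [].
- apply: val_inj; apply/rowP => i; rewrite mxE clamp1 subrr mul1r mul0r add0r.
  by [].
Qed.

End LinkPath.

Section BoundaryComponents.

Variables (R : realType) (P : spine).

Lemma boundary_pi_continuous : continuous (@boundary_pi R P).
Proof. exact: pi_continuous. Qed.

Lemma boundary_piP (a b : link_point R P) :
  boundary_pi a = boundary_pi b <-> clos_refl_sym_trans _ (@glued R P) a b.
Proof.
split=> [/eqmodP/asboolP //|ab]; apply/eqmodP; exact/asboolP.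
Qed.

Lemma boundary_pi_surj (q : boundary_carrier R P) :
  exists a, q = boundary_pi a.
Proof. by exists (generic_quotient.repr q); rewrite [RHS]reprK. Qed.

Lemma clopen_triangle (U : set (boundary_carrier R P)) c
    (x y : set_type (@link_triangle R c.2)) :
    open U -> closed U ->
  U (boundary_pi (existT _ c x)) -> U (boundary_pi (existT _ c y)).
Proof.
move=> oU cU Ux; have [g [gc g0 g1]] := link_path x y.
pose G (s : R) : boundary_carrier R P :=
  boundary_pi (existT (fun c => set_type (@link_triangle R c.2)) c (g s)).
have Gc : continuous G.
  move=> s; apply: continuous_comp; last exact: boundary_pi_continuous.
  apply: continuous_comp; [exact: gc|exact: existT_continuous].
have GU : `[0, 1]%classic `&` G @^-1` U = `[0, 1]%classic :> set R.
  apply: (@segment_connected R 0 1).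
  - by exists 0; split; rewrite /= ?in_itv /= ?lexx ?ler01 // /G g0.
  - by exists (G @^-1` U) => //; move/continuousP: Gc; apply.
  - exists (G @^-1` U) => //; move/continuous_closedP: Gc; exact.
have : (`[0, 1]%classic : set R) 1 by rewrite /= in_itv /= ler01 lexx.
by rewrite -GU => -[_]; rewrite /G /= g1.
Qed.

Let vertex_row (v w : 'I_4) : v != w ->
  (\row_i (i == w)%:R : 'rV[R]_4) \in @link_triangle R v.
Proof.
move=> vw; apply/mem_set; split.
- by rewrite mxE (negPf vw).
- by move=> i; rewrite mxE ler0n.
- under eq_bigr do rewrite mxE.
  by rewrite (bigD1 w) //= eqxx big1 ?addr0 // => i /negPf->.
Qed.

Let corner (v w : 'I_4) (vw : v != w) : set_type (@link_triangle R v) :=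
  exist (fun x => x \in @link_triangle R v) _ (vertex_row vw).

Lemma link_triangle_nonempty (c : tet P * 'I_4) :
  exists a : link_point R P, projT1 a = c.
Proof.
have [w wv] : exists w, c.2 != w by exists (lift c.2 ord0); apply: neq_lift.
by exists (existT _ c (corner wv)).
Qed.

Let glued_intro (a b : link_point R P) i :
    i <> vertex_of a -> coord a i = 0 ->
    tet_of b = (glue (tet_of a) i).1 ->
    vertex_of b = (glue (tet_of a) i).2 (vertex_of a) ->
    (forall j, coord b ((glue (tet_of a) i).2 j) = coord a j) ->
  glued a b.
Proof.
by move=> ia a0; rewrite /glued; case E: (glue _ _) => [t s] /= *; exists i;
  rewrite E.
Qed.

(** Triangles related by one step share a point: the corner [w], distinct from the vertex and from
    [i], lies on the side glued across the face [i]. *)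
Lemma clopen_vertex (U : set (boundary_carrier R P)) (a b : link_point R P) :
    open U -> closed U ->
    clos_refl_sym_trans _ (@vertex_step P) (projT1 a) (projT1 b) ->
  U (boundary_pi a) <-> U (boundary_pi b).
Proof.
move=> oU cU; move: a b => [c x] [d y] /= cd.
elim: cd x y => {c d} [c d [i [ic ->]]|c|c d _ IH|c d e _ IH1 _ IH2] x y.
- have [w wi wc] : exists2 w, i != w & c.2 != w.
    have : (0 < #|~: [set i; c.2]%SET|)%N.
      by rewrite cardsCs finset.setCK card_ord cards2; case: (_ != _).
    case/card_gt0P=> w; rewrite !inE negb_or => /andP[wi wc].
    by exists w; rewrite eq_sym.
  pose s := (glue c.1 i).2; have sc : s c.2 != s w by rewrite (inj_eq perm_inj).
  pose a := existT (fun c => set_type (@link_triangle R c.2)) c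
    (corner wc).
  pose b := existT (fun c => set_type (@link_triangle R c.2))
    ((glue c.1 i).1, s c.2) (corner sc).
  have ab : boundary_pi a = boundary_pi b.
    apply/boundary_piP/rst_step; apply: (@glued_intro a b i) => //.
    + by move=> ci; rewrite ci eqxx in ic.
    + by rewrite /coord /= mxE (negPf wi).
    + by move=> j; rewrite /coord /= !mxE (inj_eq perm_inj).
  split=> Ux.
    have := @clopen_triangle U c x (corner wc) oU cU Ux.
    by rewrite -/a ab; apply: clopen_triangle.
  have := @clopen_triangle U (_, _) y (corner sc) oU cU Ux.
  by rewrite -/b -ab; apply: clopen_triangle.
- by split; apply: clopen_triangle.
- by split=> /IH; apply.
(* Transitivity requires some point in the triangle of the intermediate vertex [d]. *)
- have [w wd] : exists w, d.2 != w by exists (lift d.2 ord0); apply: neq_lift.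
  exact: iff_trans (IH1 x (corner wd)) (IH2 _ y).
Qed.

(** A union of classes pulls back to a union of whole summands of [link_point], which is open. *)
Lemma vertex_count_open n (k : tet P * 'I_4 -> 'I_n) (A : pred 'I_n) :
    (forall a b, vertex_step a b -> k a = k b) ->
  exists U : set (boundary_carrier R P),
    open U /\ forall a, U (boundary_pi a) <-> A (k (projT1 a)).
Proof.
move=> kP; pose U : set (boundary_carrier R P) :=
  [set q | exists2 a, q = boundary_pi a & A (k (projT1 a))].
have UE a : U (boundary_pi a) <-> A (k (projT1 a)).
  split=> [[b /boundary_piP ab]|Aa]; last by exists a.
  suff -> : k (projT1 a) = k (projT1 b) by [].
  elim: ab => {a b} [a b [i [ai [_ ab]]]|a|a b _ ->|a b c _ -> _ ->] //.
  apply: kP; exists i; split; first by apply/eqP.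
  by move: ab; case: (glue _ _) => t' s [<- <- _]; rewrite -surjective_pairing.
exists U; split=> //.
suff : open (@boundary_pi R P @^-1` U) by [].
apply/sigT_openP => c.
have [Ac|nAc] := boolP (A (k c)).
  rewrite (_ : _ @^-1` _ = setT); first exact: openT.
  by apply/seteqP; split=> // x _; apply/UE.
rewrite (_ : _ @^-1` _ = set0); first exact: open0.
by apply/seteqP; split=> // x /UE; rewrite /= (negPf nAc).
Qed.


End BoundaryComponents.

(** A continuous surjection cannot increase the number of components: points chosen above distinct
    components of the target are separated by the preimage of a clopen set. *)
Lemma boundary_surjection (R : realType) (P Q : spine) (m n : nat)
    (f : boundary R P -> boundary R Q) : continuous f ->
  (forall y, exists x, f x = y) -> vertex_count P m -> vertex_count Q n ->
  (n <= m)%N.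
Proof.
move=> fc fS [k [kS kP]] [l [lS lP]].
have l_step a b : vertex_step a b -> l a = l b by move/(@rst_step _ _ _ _)/lP.
have ex_val (c : 'I_n) :
  exists (d : 'I_m) (a : link_point R P) (b : link_point R Q),
    [/\ k (projT1 a) = d, l (projT1 b) = c & f (boundary_pi a) = boundary_pi b].
  have [b0 b0c] := lS c; have [b bE] := link_triangle_nonempty R b0.
  have [x xE] := fS (boundary_pi b).
  have [a xa] := boundary_pi_surj x.
  by exists (k (projT1 a)), a, b; rewrite -xa bE.
have [phi phiP] := choice ex_val.
have phi_inj : injective phi.
  move=> c c' cc'; have [a [b [ka lb fab]]] := phiP c.
  have [a' [b' [ka' lb' fab']]] := phiP c'.
  have [U [oU UP]] := vertex_count_open R (pred1 c) l_step.
  have [V [oV VP]] := vertex_count_open R (predC1 c) l_step.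
  (* [V] is the union of the other components, so [U] is closed as well as open. *)
  have UV : U = ~` V.
    apply/seteqP; split=> q; have [d ->] := boundary_pi_surj q.
      by move=> /UP/eqP Ud /VP; rewrite /= Ud eqxx.
    by move=> Vd; apply/UP; apply/negPn/negP => nUd; apply/Vd/VP.
  have cU : closed (f @^-1` U).
    by rewrite UV; apply: (proj1 (continuous_closedP f)) => //; apply: open_closedC.
  have oU' : open (f @^-1` U) by move/continuousP: fc; apply.
  have := clopen_vertex (a := a) (b := a') oU' cU.
  rewrite -kP ka ka' cc' => /(_ erefl) /=; rewrite fab fab' => UU.
  have /UU/UP/eqP : U (boundary_pi b) by apply/UP/eqP; rewrite lb.
  by rewrite lb' => ->.
by have := leq_card phi phi_inj; rewrite !card_ord.
Qed.

End BoundaryTopology.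

Lemma homeo_vertex_count (R : realType) (S : bicolored_space) (P Q : spine)
    (m n : nat) :
    bicolored_homeo (boundary R P) S -> bicolored_homeo (boundary R Q) S ->
  vertex_count P m -> vertex_count Q n -> m = n.
Proof.
have le_count (P' Q' : spine) (m' n' : nat) :
    bicolored_homeo (boundary R P') S -> bicolored_homeo (boundary R Q') S ->
    vertex_count P' m' -> vertex_count Q' n' -> (n' <= m')%N.
  case=> f [[g [fc _ fg gf] _ _]] [f' [[g' [_ gc' fg' gf'] _ _]]].
  apply: (@boundary_surjection R P' Q' _ _ (g' \o f)).
    move=> x; apply: continuous_comp.
      exact: (proj2 (continuous_subspace_setT f) fc).
    exact: (proj2 (continuous_subspace_setT g') gc').
  move=> y; exists (g (f' y)) => /=.
  by rewrite (gf _ _).2 ?(fg' _ _).2.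
by move=> PS QS Pm Qn; apply/eqP; rewrite eqn_leq (le_count _ _ _ _ QS PS Qn Pm)
  (le_count _ _ _ _ PS QS Pm Qn).
Qed.

Lemma vertex_step_iso (P Q : spine) : spine_iso P Q ->
  exists F : tet P * 'I_4 -> tet Q * 'I_4, bijective F /\
    forall a b, vertex_step a b <-> vertex_step (F a) (F b).
Proof.
case/spine_isoP=> f [p [[g fK gK] _ _ gP]].
exists (fun a => (f a.1, p a.1 a.2)); split.
  exists (fun b => (g b.1, (p (g b.1))^-1%g b.2)) => [[t i]|[u j]] /=.
    by rewrite fK permK.
  by rewrite gK permKV.
move=> [t v] [u w]; split=> -[i /= [iv E]].
  case: E => -> ->; exists (p t i); rewrite (inj_eq perm_inj); split=> //=.
  by rewrite gP /= !permM permK.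
exists ((p t)^-1%g i); have ip : p t ((p t)^-1%g i) = i by rewrite permKV.
split; first by rewrite -(inj_eq (@perm_inj _ (p t))) ip.
move: E; rewrite -{1 2}ip gP /= !permM permK => -[/(can_inj fK) -> ].
by move/perm_inj->.
Qed.

Lemma clos_map (T U : Type) (r : T -> T -> Prop) (s : U -> U -> Prop) (F : T -> U) :
    (forall a b, r a b -> s (F a) (F b)) ->
  forall a b, clos_refl_sym_trans T r a b -> clos_refl_sym_trans U s (F a) (F b).
Proof.
move=> rs a b; elim=> {a b} [a b /rs|a|a b _|a b c _ + _].
- exact: rst_step.
- exact: rst_refl.
- exact: rst_sym.
- exact: rst_trans.
Qed.

Lemma vertex_count_of (P : spine) (K : finType) (k : tet P * 'I_4 -> K)
    (r : K -> tet P * 'I_4) :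
    (forall a b, vertex_step a b -> k a = k b) ->
    (forall a, clos_refl_sym_trans _ (@vertex_step P) a (r (k a))) ->
    cancel r k ->
  vertex_count P #|K|.
Proof.
move=> kstep kr rk; exists (fun a => enum_rank (k a)); split=> [c|a b].
  by exists (r (enum_val c)); rewrite rk enum_valK.
split=> [/enum_rank_inj kab|].
  by apply: rst_trans (kr a) _; rewrite kab; apply: rst_sym; apply: kr.
elim=> {a b} [a b /kstep->|a|a b _ ->|a b c _ -> _ ->] //.
Qed.

Lemma vertex_count_iso (P Q : spine) n :
  spine_iso P Q -> vertex_count Q n -> vertex_count P n.
Proof.
case/vertex_step_iso=> F [[G FK GK] FP] [k [kS kP]].
exists (k \o F); split=> [c|a b].
  by have [a <-] := kS c; exists (G a); rewrite /= GK.
split=> [/kP|].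
  rewrite -{2}[a]FK -{2}[b]FK; apply: clos_map => {a b} a b ab.
  by apply/FP; rewrite !GK.
by move=> ab; apply/kP; apply: clos_map ab => c d /FP.
Qed.

Lemma ordered_vertex_step (P : spine) (a b : tet P * 'I_4) : ordered P ->
  vertex_step a b <-> exists2 i, i != a.2 &
    b = ((pairing (a.1, i)).1, lift_perm i (pairing (a.1, i)).2 1%g a.2).
Proof.
move=> oP; split=> [[i [ia ->]]|[i ia ->]]; exists i => //.
  by rewrite /pairing /= -(ordered_glue oP).
by rewrite /pairing /= -(ordered_glue oP).
Qed.

Lemma val_lift_perm n (i j v : 'I_n.+1) : i != v ->
  lift_perm i j 1%g v = bump j (unbump i v) :> nat.
Proof.
by case/unlift_some=> w -> _; rewrite lift_perm_lift perm1 /= bumpK.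
Qed.

(** * Rigid spines *)

Section Rigid.

Variable P : spine.
Hypothesis oP : ordered P.

Lemma self_pairing_parity (t : tet P) (i : 'I_4) :
  (pairing (t, i)).1 = t -> odd (pairing (t, i)).2 = ~~ odd i.
Proof.
have := gluing_sgn (ordered_gluing oP) (t, i); rewrite /face_sgn [(t, i).1]/=.
move=> + tE; rewrite tE [(t, i).2]/=.
by move: (sgn t) (odd i) (odd (pairing (t, i)).2) => [] [] [].
Qed.

Lemma closed_tet_unique (t : tet P) :
  (forall i, (pairing (t, i)).1 = t) -> forall u, u = t.
Proof.
move=> tP u; apply/eqP.
rewrite (gluing_connected (ordered_gluing oP) (g := eq_op^~ t) _ u t) // => x.
apply/eqP/eqP => xt; last by rewrite [x]surjective_pairing xt tP.
by rewrite -(pairingK x) [pairing x]surjective_pairing xt tP.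
Qed.

Definition bent_tet (t : tet P) : Prop :=
  pairing (t, inord 0) = (t, inord 3) /\ pairing (t, inord 1) = (t, inord 2).

Definition split_tet (t : tet P) : Prop :=
  pairing (t, inord 0) = (t, inord 1) /\ pairing (t, inord 2) = (t, inord 3).

(* The tetrahedra of a necklace form a cycle, being glued along their faces 0 and
   along their faces 3 alternately. *)
Definition necklace : Prop := forall t : tet P,
  [/\ pairing (t, inord 1) = (t, inord 2),
      (pairing (t, inord 0)).2 = inord 0 & (pairing (t, inord 3)).2 = inord 3].

Let inord4_inj k l : inord k = inord l :> 'I_4 ->
  (k < 4)%N -> (l < 4)%N -> k = l.
Proof. by move=> /(congr1 val) /= kl k4 l4; move: kl; rewrite !inordK. Qed.

(** The faces 1 and 2 must be glued within their tetrahedron, and parity leaves 0 or 2 as partner of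
    1, and 1 or 3 as partner of 2. If 1 meets 0, then 2 meets 3; otherwise 1 meets 2, and the faces
    0 and 3 meet each other or leave with their own label. *)
Lemma not_slidable_cases : ~ slidable P ->
  [\/ exists2 t, (forall u, u = t) & bent_tet t,
      exists2 t, (forall u, u = t) & split_tet t | necklace].
Proof.
move=> nS.
have nsl (t : tet P) (i : 'I_4) : [\/ (pairing (t, i)).1 = t,
    (i : nat, (pairing (t, i)).2 : nat) = (0, 0)%N |
    (i : nat, (pairing (t, i)).2 : nat) = (3, 3)%N].
  have [?|n1] := EM ((pairing (t, i)).1 = t); first exact: Or31.
  have [?|n2] := EM ((i : nat, (pairing (t, i)).2 : nat) = (0, 0)%N).
    exact: Or32.
  have [?|n3] := EM ((i : nat, (pairing (t, i)).2 : nat) = (3, 3)%N).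
    exact: Or33.
  by case: nS; exists (t, i); split=> // /esym.
have mid (t : tet P) k : k = 1%N \/ k = 2%N -> (pairing (t, inord k)).1 = t.
  move=> k12; case: (nsl t (inord k)) => // -[].
    by case: k12 => ->; rewrite inordK.
  by case: k12 => ->; rewrite inordK.
have f1 (t : tet P) : pairing (t, inord 1) = (t, inord 2) \/
            pairing (t, inord 1) = (t, inord 0).
  have m1 := mid t 1%N (or_introl erefl).
  have := self_pairing_parity m1.
  rewrite [pairing _]surjective_pairing m1.
  by case: (ord4P (pairing (t, inord 1)).2) => ->; rewrite !inordK //; auto.
have f2 (t : tet P) : pairing (t, inord 2) = (t, inord 1) \/
            pairing (t, inord 2) = (t, inord 3).
  have m1 := mid t 2%N (or_intror erefl).
  have := self_pairing_parity m1.
  rewrite [pairing _]surjective_pairing m1.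
  by case: (ord4P (pairing (t, inord 2)).2) => ->; rewrite !inordK //; auto.
have [[t t10]|n10] := EM (exists t : tet P, pairing (t, inord 1) = (t, inord 0)).
  have t01 : pairing (t, inord 0) = (t, inord 1) by rewrite -t10 pairingK.
  have t23 : pairing (t, inord 2) = (t, inord 3).
    case: (f2 t) => // t21; have := pairingK (t, inord 2); rewrite t21 t10.
    by case=> /inord4_inj/(_ isT isT).
  have t32 : pairing (t, inord 3) = (t, inord 2) by rewrite -t23 pairingK.
  apply: Or32; exists t => //; apply: closed_tet_unique => i.
  by case: (ord4P i) => ->; rewrite ?t10 ?t01 ?t23 ?t32.
have f12 (t : tet P) : pairing (t, inord 1) = (t, inord 2).
  by case: (f1 t) => // t10; case: n10; exists t.
have f21 (t : tet P) : pairing (t, inord 2) = (t, inord 1) by rewrite -(f12 t) pairingK.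
have [[t t03]|n03] := EM (exists t : tet P, pairing (t, inord 0) = (t, inord 3)).
  have t30 : pairing (t, inord 3) = (t, inord 0) by rewrite -t03 pairingK.
  apply: Or31; exists t => //; apply: closed_tet_unique => i.
  by case: (ord4P i) => ->; rewrite ?f12 ?f21 ?t03 ?t30.
apply: Or33 => t; split=> //.
- case: (nsl t (inord 0)) => [t0|[_ t0]|[]]; last by rewrite inordK.
    have := self_pairing_parity t0.
    case: (ord4P (pairing (t, inord 0)).2) => jE; rewrite ?jE ?inordK // => _.
      have := pairingK (t, inord 0).
      rewrite [pairing (t, _)]surjective_pairing t0 jE f12.
      by case=> /inord4_inj/(_ isT isT).
    by case: n03; exists t; rewrite [LHS]surjective_pairing t0 jE.
  by apply: val_inj; rewrite /= t0 inordK.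
- case: (nsl t (inord 3)) => [t0|[]|[_ t0]]; first 1 last.
  + by rewrite inordK.
  + by apply: val_inj; rewrite /= t0 inordK.
  have := self_pairing_parity t0.
  case: (ord4P (pairing (t, inord 3)).2) => jE; rewrite ?jE ?inordK // => _.
    case: n03; exists t; rewrite -(pairingK (t, inord 3)).
    by rewrite [pairing (t, inord 3)]surjective_pairing t0 jE.
  have := pairingK (t, inord 3).
  rewrite [pairing (t, _)]surjective_pairing t0 jE f21.
  by case=> /inord4_inj/(_ isT isT).
Qed.

End Rigid.

(** * Boundary components of the rigid spines *)

Section Counts.

Variable P : spine.
Hypothesis oP : ordered P.

Notation linked := (clos_refl_sym_trans _ (@vertex_step P)).

Lemma vertex_step_pairing (t u : tet P) (i j v w : 'I_4) :
    pairing (t, i) = (u, j) -> i != v -> w = bump j (unbump i v) :> nat ->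
  vertex_step (t, v) (u, w).
Proof.
move=> tu iv wE; apply/(ordered_vertex_step _ _ oP); exists i; rewrite // tu.
by congr (_, _); apply: val_inj; rewrite /= val_lift_perm.
Qed.

Lemma vertex_step_inv (t : tet P) v b : vertex_step (t, v) b -> exists i : 'I_4,
  [/\ i != v, b.1 = (pairing (t, i)).1 &
      b.2 = bump (pairing (t, i)).2 (unbump i v) :> nat].
Proof.
case/(ordered_vertex_step _ _ oP)=> i iv ->; exists i; split=> //.
exact: val_lift_perm.
Qed.

Let inord_neq k l : (k < 4)%N -> (l < 4)%N -> k != l ->
  (inord k : 'I_4) != inord l.
Proof. by move=> k4 l4; rewrite -val_eqE /= !inordK. Qed.

Lemma linked_pairing (t u : tet P) i j v w :
    pairing (t, inord i) = (u, inord j) -> (i < 4)%N -> (j < 4)%N ->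
    (v < 4)%N -> (w < 4)%N -> i != v -> w = bump j (unbump i v) ->
  linked (t, inord v) (u, inord w).
Proof.
move=> tu i4 j4 v4 w4 iv wE; apply: rst_step.
by apply: vertex_step_pairing tu (inord_neq _ _ _) _; rewrite ?inordK.
Qed.

(** The gluing of the faces 0 and 3 sends the vertices 1, 2, 3 to 0, 1, 2 and thus identifies all
    four. *)
Lemma bent_vertex_count (t : tet P) :
  (forall u, u = t) -> bent_tet t -> vertex_count P 1.
Proof.
move=> tP [t03 t12]; rewrite -card_unit.
apply: (@vertex_count_of _ _ (fun=> tt) (fun=> (t, inord 0))) => // [[u v]|[]//].
have l10 : linked (t, inord 1) (t, inord 0) by apply: linked_pairing t03 _ _ _ _ _ _.
have l21 : linked (t, inord 2) (t, inord 1) by apply: linked_pairing t03 _ _ _ _ _ _.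
have l32 : linked (t, inord 3) (t, inord 2) by apply: linked_pairing t03 _ _ _ _ _ _.
have l20 := rst_trans _ _ _ _ _ l21 l10.
rewrite (tP u); case: (ord4P v) => -> //; first exact: rst_refl.
exact: rst_trans l32 l20.
Qed.

(** One gluing identifies the vertices 0 and 1, the other 2 and 3; both otherwise preserve the
    labels. *)
Lemma split_vertex_count (t : tet P) :
  (forall u, u = t) -> split_tet t -> vertex_count P 2.
Proof.
move=> tP [t01 t23]; rewrite -card_bool.
have t10 : pairing (t, inord 1) = (t, inord 0) by rewrite -t01 pairingK.
have t32 : pairing (t, inord 3) = (t, inord 2) by rewrite -t23 pairingK.
apply: (@vertex_count_of _ _ (fun a => (a.2 < 2)%N)
  (fun b : bool => (t, if b then inord 0 else inord 2))) => [a b|[u v]|[]] /=.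
- case: a => u v; rewrite (tP u) => /vertex_step_inv[i [iv _ ->]]; move: iv.
  case: (ord4P i) => ->; rewrite ?t01 ?t10 ?t23 ?t32 -val_eqE /= ?inordK //;
    by case: v => [[|[|[|[|]]]]].
- rewrite (tP u); case: (ord4P v) => ->; rewrite inordK //=;
    try exact: rst_refl.
    by apply: linked_pairing t01 _ _ _ _ _ _.
  by apply: linked_pairing t23 _ _ _ _ _ _.
- by rewrite inordK.
- by rewrite inordK.
Qed.

Section Necklace.

Hypothesis PN : necklace P.

Definition turn0 (t : tet P) : tet P := (pairing (t, inord 0)).1.
Definition turn3 (t : tet P) : tet P := (pairing (t, inord 3)).1.

Lemma pairing_turn0 (t : tet P) : pairing (t, inord 0) = (turn0 t, inord 0).
Proof. by rewrite [LHS]surjective_pairing; have [_ -> _] := PN t. Qed.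

Lemma pairing_turn3 (t : tet P) : pairing (t, inord 3) = (turn3 t, inord 3).
Proof. by rewrite [LHS]surjective_pairing; have [_ _ ->] := PN t. Qed.

Lemma pairing_loop (t : tet P) : pairing (t, inord 1) = (t, inord 2).
Proof. by have [-> _ _] := PN t. Qed.

Lemma pairing_loop' (t : tet P) : pairing (t, inord 2) = (t, inord 1).
Proof. by rewrite -pairing_loop pairingK. Qed.

Lemma turn0K : involutive turn0.
Proof. by move=> t; rewrite {1}/turn0 -pairing_turn0 pairingK. Qed.

Lemma turn3K : involutive turn3.
Proof. by move=> t; rewrite {1}/turn3 -pairing_turn3 pairingK. Qed.

Lemma sgn_turn0 (t : tet P) : sgn (turn0 t) = ~~ sgn t.
Proof.
have := gluing_sgn (ordered_gluing oP) (t, inord 0).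
by rewrite pairing_turn0 /face_sgn [_.2]/= [_.1]/= [_.1]/= inordK // !addbF.
Qed.

Lemma sgn_turn3 (t : tet P) : sgn (turn3 t) = ~~ sgn t.
Proof.
have := gluing_sgn (ordered_gluing oP) (t, inord 3).
rewrite pairing_turn3 /face_sgn [_.2]/= [_.1]/= [_.1]/= inordK //.
by move: (sgn _) (sgn _) => [] [].
Qed.

Lemma necklace_ind (g : tet P -> bool) :
    (forall t, g (turn0 t) = g t) -> (forall t, g (turn3 t) = g t) ->
  forall t u, g t = g u.
Proof.
move=> g0 g3; apply: (gluing_connected (ordered_gluing oP)) => -[t i].
by case: (ord4P i) => ->; rewrite ?pairing_turn0 ?pairing_turn3 ?pairing_loop
  ?pairing_loop' /=.
Qed.

(** The vertices 1 and 2 of all tetrahedra form one class, coded by [None]. The vertices 0 are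
    identified in pairs by [turn3], the vertices 3 in pairs by [turn0]. Each pair has one
    tetrahedron of each sign: the positive one codes a class of vertices 0, the negative one a class
    of vertices 3. *)
Lemma necklace_vertex_count : vertex_count P #|tet P|.+1.
Proof.
rewrite -card_option.
have [t0 _] : exists t0 : tet P, t0 \in predT.
  by apply/card_gt0P/spine_nonempty.
pose k (a : tet P * 'I_4) : option (tet P) :=
  if (a.2 : nat) == 0%N then Some (if sgn a.1 then a.1 else turn3 a.1)
  else if (a.2 : nat) == 3%N then Some (if sgn a.1 then turn0 a.1 else a.1)
  else None.
pose r (o : option (tet P)) : tet P * 'I_4 := match o with
  | Some u => (u, if sgn u then inord 0 else inord 3)
  | None => (t0, inord 1)
  end.
apply: (@vertex_count_of _ _ k r).
- move=> [t v] [u w] /vertex_step_inv[i]; rewrite /k.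
  case: (ord4P i) => ->; rewrite ?pairing_turn0 ?pairing_turn3 ?pairing_loop
    ?pairing_loop' -val_eqE /= ?inordK // => -[iv -> ->];
    case: v iv => [[|[|[|[|]]]]] //= _ _;
    by rewrite ?sgn_turn0 ?sgn_turn3 ?turn0K ?turn3K; case: (sgn t).
- move=> [t v]; have l0 : linked (t, inord 0) (turn3 t, inord 0).
    by apply: linked_pairing (pairing_turn3 t) _ _ _ _ _ _.
  have l3 : linked (t, inord 3) (turn0 t, inord 3).
    by apply: linked_pairing (pairing_turn0 t) _ _ _ _ _ _.
  have l1 : linked (t, inord 1) (t0, inord 1).
    pose g u := `[< linked (u, inord 1) (t0, inord 1) >].
    suff : g t by move/asboolP.
    rewrite (necklace_ind (g := g) _ _ t t0) => [|u|u].
    + by apply/asboolP; apply: rst_refl.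
    + have uu : linked (u, inord 1) (turn0 u, inord 1).
        by apply: linked_pairing (pairing_turn0 u) _ _ _ _ _ _.
      apply/asboolP/asboolP; apply: rst_trans => //; exact: rst_sym.
    + have uu : linked (u, inord 1) (turn3 u, inord 1).
        by apply: linked_pairing (pairing_turn3 u) _ _ _ _ _ _.
      apply/asboolP/asboolP; apply: rst_trans => //; exact: rst_sym.
  have l21 : linked (t, inord 2) (t, inord 1).
    by apply: linked_pairing (pairing_loop t) _ _ _ _ _ _.
  case: (ord4P v) => ->; rewrite /k /= inordK //=.
  + by case: ifP => st; rewrite ?sgn_turn3 st //; apply: rst_refl.
  + exact: rst_trans l21 l1.
  + by case: ifP => st; rewrite ?sgn_turn0 st //; apply: rst_refl.
- case=> [u|]; rewrite /k /r /=; last by rewrite !inordK.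
  by case su: (sgn u); rewrite /= inordK //= su.
Qed.

End Necklace.
End Counts.

(** * Isomorphisms within each family of rigid spines *)

Lemma one_tet_iso (P Q : spine) (t : tet P) (u : tet Q) :
    ordered P -> ordered Q -> (forall t', t' = t) -> (forall u', u' = u) ->
    sgn t = sgn u ->
    (forall i, (pairing (t, i)).2 = (pairing (u, i)).2) ->
  spine_iso P Q.
Proof.
move=> oP oQ tP uQ tu piE; apply: (@ordered_iso _ _ (fun=> u)) => //.
- by exists (fun=> t) => v; rewrite ?(tP v) ?(uQ v).
- by move=> t'; rewrite (tP t').
- move=> [t' i]; rewrite (tP t') [(t, i).2]/= piE [LHS]surjective_pairing.
  by rewrite (uQ (pairing (u, i)).1).
Qed.

Lemma bent_iso (P Q : spine) (t : tet P) (u : tet Q) :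
    ordered P -> ordered Q -> (forall t', t' = t) -> (forall u', u' = u) ->
    sgn t = sgn u -> bent_tet t -> bent_tet u ->
  spine_iso P Q.
Proof.
move=> oP oQ tP uQ tu [t0 t1] [u0 u1]; apply: one_tet_iso tP uQ tu _ => // i.
have t3 : pairing (t, inord 3) = (t, inord 0) by rewrite -t0 pairingK.
have t2 : pairing (t, inord 2) = (t, inord 1) by rewrite -t1 pairingK.
have u3 : pairing (u, inord 3) = (u, inord 0) by rewrite -u0 pairingK.
have u2 : pairing (u, inord 2) = (u, inord 1) by rewrite -u1 pairingK.
by case: (ord4P i) => ->; rewrite ?t0 ?t1 ?t2 ?t3 ?u0 ?u1 ?u2 ?u3.
Qed.

Lemma split_iso (P Q : spine) (t : tet P) (u : tet Q) :
    ordered P -> ordered Q -> (forall t', t' = t) -> (forall u', u' = u) ->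
    sgn t = sgn u -> split_tet t -> split_tet u ->
  spine_iso P Q.
Proof.
move=> oP oQ tP uQ tu [t0 t2] [u0 u2]; apply: one_tet_iso tP uQ tu _ => // i.
have t1 : pairing (t, inord 1) = (t, inord 0) by rewrite -t0 pairingK.
have t3 : pairing (t, inord 3) = (t, inord 2) by rewrite -t2 pairingK.
have u1 : pairing (u, inord 1) = (u, inord 0) by rewrite -u0 pairingK.
have u3 : pairing (u, inord 3) = (u, inord 2) by rewrite -u2 pairingK.
by case: (ord4P i) => ->; rewrite ?t0 ?t1 ?t2 ?t3 ?u0 ?u1 ?u2 ?u3.
Qed.

Section NecklaceOrbit.

Variable P : spine.
Hypotheses (oP : ordered P) (PN : necklace P).

(** Two steps along the cycle preserve the sign, and the positive tetrahedra form a single orbit. *)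
Definition turn (t : tet P) : tet P := turn3 (turn0 t).

Lemma turn_inj : injective turn.
Proof.
apply: inj_comp (can_inj (turn3K PN)) (can_inj (turn0K PN)).
Qed.

Lemma sgn_turn t : sgn (turn t) = sgn t.
Proof. by rewrite /turn sgn_turn3 // sgn_turn0 // negbK. Qed.

Lemma positive_orbit (t0 t : tet P) : sgn t0 -> fconnect turn t0 t = sgn t.
Proof.
(* A negative tetrahedron is tested through its positive neighbour [turn3 u], which makes [g]
   invariant under both involutions. *)
move=> st0; pose g u := if sgn u then fconnect turn t0 u
                        else fconnect turn t0 (turn3 u).
have g1 u : g u.
  rewrite (necklace_ind oP PN (g := g) _ _ u t0) => [|v|v].
  - by rewrite /g st0 connect0.
  - rewrite /g sgn_turn0 //; case: (sgn v) => /=.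
      by rewrite [RHS](same_fconnect1_r turn_inj).
    by rewrite [LHS](same_fconnect1_r turn_inj) /turn turn0K.
  - by rewrite /g sgn_turn3 //; case: (sgn v); rewrite //= turn3K.
apply/idP/idP => [|st]; last by have := g1 t; rewrite /g st.
by move/iter_findex <-; elim: findex => //= k; rewrite sgn_turn.
Qed.

Lemma necklace_order (t0 : tet P) : sgn t0 ->
  #|tet P| = (fingraph.order turn t0).*2.
Proof.
move=> st0; rewrite -(cardC (@sgn P)) -addnn; congr addn.
  by apply: eq_card => t; rewrite !inE positive_orbit.
rewrite -(card_imset _ (can_inj (turn0K PN))); apply: eq_card => t.
rewrite [RHS]positive_orbit // -[RHS]negbK -(sgn_turn0 oP PN).
apply/imsetP/idP => [[u uN ->]|tN]; first by rewrite turn0K.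
by exists (turn0 t); rewrite // turn0K.
Qed.

Lemma positive_tet : exists t : tet P, sgn t.
Proof.
have [t _] : exists t : tet P, t \in predT by apply/card_gt0P/spine_nonempty.
have [st|nst] := boolP (sgn t); first by exists t.
by exists (turn0 t); rewrite sgn_turn0.
Qed.

End NecklaceOrbit.

(** The positive orbits have equal length and are matched by [F] from arbitrary positive base
    points. Conjugation by [turn0] extends [F] to the negative tetrahedra, and compatibility with
    [turn3] comes from that with [turn]. *)
Lemma necklace_iso (P Q : spine) : ordered P -> ordered Q ->
  necklace P -> necklace Q -> #|tet P| = #|tet Q| -> spine_iso P Q.
Proof.
move=> oP oQ PN QN PQ.
have [t0 st0] := positive_tet oP PN; have [u0 su0] := positive_tet oQ QN.
have ord : fingraph.order (@turn P) t0 = fingraph.order (@turn Q) u0.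
  by apply: double_inj; rewrite -!necklace_order.
pose F t := iter (findex (@turn P) t0 t) (@turn Q) u0.
pose f t := if sgn t then F t else turn0 (F (turn0 t)).
have sF t : sgn (F t) by rewrite /F; elim: findex => //= k; rewrite sgn_turn.
have F_turn t : sgn t -> F (turn t) = turn (F t).
  move=> st; have ct : fconnect (@turn P) t0 t by rewrite positive_orbit.
  have := findex_max ct; rewrite /F -{2}(iter_findex ct) -!iterS.
  (* At the last place of the orbit [turn] returns to the base point, on both sides at once since
     the orders agree. *)
  rewrite leq_eqVlt => /orP[/eqP E|lt_k].
    by rewrite E iter_order ?findex0 ?ord ?iter_order //; apply: turn_inj.
  by rewrite findex_iter.
have F_inj t t' : sgn t -> sgn t' -> F t = F t' -> t = t'.
  move=> st st'; have ct : fconnect (@turn P) t0 t by rewrite positive_orbit.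
  have ct' : fconnect (@turn P) t0 t' by rewrite positive_orbit.
  have := findex_max ct'; have := findex_max ct; rewrite ord => lt_t lt_t'.
  rewrite /F => E; rewrite -(iter_findex ct) -(iter_findex ct').
  by rewrite -(findex_iter lt_t) E (findex_iter lt_t').
have s0 t := sgn_turn0 oP PN t; have s0' t := sgn_turn0 oQ QN t.
have s3 t := sgn_turn3 oP PN t.
have k0 := turn0K PN; have k0' := turn0K QN.
have k3 := turn3K PN; have k3' := turn3K QN.
have fS t : sgn (f t) = sgn t.
  by rewrite /f; case st: (sgn t); rewrite ?s0' sF.
have f0 t : f (turn0 t) = turn0 (f t).
  by rewrite /f s0; case st: (sgn t); rewrite /= ?k0 ?k0'.
have f3_neg t : ~~ sgn t -> f (turn3 t) = turn3 (f t).
  move=> st; rewrite /f s3 (negPf st) /=.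
  have := @F_turn (turn0 t); rewrite s0 st => /(_ isT).
  by rewrite /turn k0.
have f3 t : f (turn3 t) = turn3 (f t).
  have [st|/f3_neg //] := boolP (sgn t).
  by rewrite -[in RHS](k3 t) (f3_neg (turn3 t)) ?k3' // s3 st.
apply: (@ordered_iso _ _ f) => //.
- apply: inj_card_bij; last by rewrite PQ.
  move=> t t' tt'; have := congr1 (@sgn Q) tt'; rewrite !fS => stt'.
  move: tt'; rewrite /f -stt'; case: ifP => st; first by apply: F_inj; rewrite -?stt'.
  move/(can_inj k0')/F_inj; rewrite !s0 -stt' st => /(_ isT isT).
  exact: can_inj.
- move=> [t i]; rewrite [(t, i).1]/= [(t, i).2]/=.
  case: (ord4P i) => ->.
  + by rewrite (pairing_turn0 PN) (pairing_turn0 QN) /= f0.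
  + by rewrite (pairing_loop PN) (pairing_loop QN).
  + by rewrite (pairing_loop' PN) (pairing_loop' QN).
  + by rewrite (pairing_turn3 PN) (pairing_turn3 QN) /= f3.
Qed.

(** * Rigid spines with a given boundary *)

Lemma rigid_not_slidable (P P0 : spine) :
  rigid P -> spine_iso P P0 -> ordered P0 -> ~ slidable P0.
Proof.
move=> rP PP0 oP0 /(slidable_birth oP0)[[Q P0Q] _].
by case: (rP Q) => + _; apply; apply: up_to_iso_l P0Q.
Qed.

(** The component count and one sign determine a rigid spine; the boundary fixes the count, and two
    of three signs agree. *)
Lemma rigid_spines_boundary (R : realType) (S : bicolored_space)
    (P1 P2 P3 : spine) :
    rigid P1 -> rigid P2 -> rigid P3 ->
    bicolored_homeo (boundary R P1) S ->
    bicolored_homeo (boundary R P2) S ->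
    bicolored_homeo (boundary R P3) S ->
  spine_iso P1 P2 \/ spine_iso P1 P3 \/ spine_iso P2 P3.
Proof.
pose kind (P0 : spine) n (s : bool) : Prop :=
  [\/ n = 1%N /\ exists t : tet P0,
        [/\ forall u, u = t, bent_tet t & sgn t = s],
      n = 2%N /\ exists t : tet P0,
        [/\ forall u, u = t, split_tet t & sgn t = s] |
      [/\ necklace P0, n = #|tet P0|.+1 & (2 < n)%N]].
have kindP P : rigid P -> exists P0 n s,
    [/\ spine_iso P P0, ordered P0, vertex_count P n & kind P0 n s].
  move=> rP; have [P0 [PP0 oP0]] := ordered_spine P; exists P0.
  case: (not_slidable_cases oP0 (rigid_not_slidable rP PP0 oP0)) =>
    [[t tP bt]|[t tP st]|PN].
  - exists 1%N, (sgn t); split=> //; last by apply: Or31; split=> //; exists t.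
    exact: vertex_count_iso PP0 (bent_vertex_count oP0 tP bt).
  - exists 2%N, (sgn t); split=> //; last by apply: Or32; split=> //; exists t.
    exact: vertex_count_iso PP0 (split_vertex_count oP0 tP st).
  (* The sign [true] is a convention here, a necklace having tetrahedra of both signs. *)
  - exists #|tet P0|.+1, true; split=> //.
      exact: vertex_count_iso PP0 (necklace_vertex_count oP0 PN).
    apply: Or33; split=> //; rewrite ltnS.
    have [t st] := positive_tet oP0 PN; rewrite (necklace_order oP0 PN st).
    have : (0 < fingraph.order (@turn P0) t)%N by apply: fingraph.order_gt0.
    by lia.
have kind_iso P P' P0 P0' n s : spine_iso P P0 -> spine_iso P' P0' ->
    ordered P0 -> ordered P0' -> kind P0 n s -> kind P0' n s -> spine_iso P P'.
  move=> PP0 PP0' oP0 oP0' k k'.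
  suff P00 : spine_iso P0 P0'.
    by apply: spine_iso_trans PP0 (spine_iso_trans P00 (spine_iso_sym PP0')).
  case: k k' => [[-> [t [tP bt <-]]]|[-> [t [tP st <-]]]|[PN ->]].
  - case=> [[_ [u [uP bu su]]]|[//]|[_ _ //]].
    exact: bent_iso tP uP (esym su) bt bu.
  - case=> [[//]|[_ [u [uP bu su]]]|[_ _ //]].
    exact: split_iso tP uP (esym su) st bu.
  - move=> k3 [[E _]|[E _]|[PN' [E] _]]; [by rewrite E in k3|by rewrite E in k3|].
    exact: necklace_iso.
move=> r1 r2 r3 h1 h2 h3.
have [P01 [n1 [s1 [i1 o1 c1 k1]]]] := kindP _ r1.
have [P02 [n2 [s2 [i2 o2 c2 k2]]]] := kindP _ r2.
have [P03 [n3 [s3 [i3 o3 c3 k3]]]] := kindP _ r3.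
have n12 := homeo_vertex_count h1 h2 c1 c2; have n13 := homeo_vertex_count h1 h3 c1 c3.
subst n2 n3.
have [s12|s12] := eqVneq s1 s2.
  by left; apply: kind_iso i1 i2 o1 o2 k1 _; rewrite s12.
have [s13|s13] := eqVneq s1 s3.
  by right; left; apply: kind_iso i1 i3 o1 o3 k1 _; rewrite s13.
right; right; apply: kind_iso i2 i3 o2 o3 k2 _.
by move: s1 s2 s3 s12 s13 {k1} k3 => [] [] [].
Qed.

Theorem proposition3p1 (R : realType) :
  (forall S : bicolored_space, closed_bicolored_surface R S ->
     forall P1 P2 P3 : spine,
       rigid P1 -> rigid P2 -> rigid P3 ->
       bicolored_homeo (boundary R P1) S ->
       bicolored_homeo (boundary R P2) S ->
       bicolored_homeo (boundary R P3) S ->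
       spine_iso P1 P2 \/ spine_iso P1 P3 \/ spine_iso P2 P3)
  /\
  (forall P Q : spine, ~ rigid P -> ~ rigid Q ->
     related (fun P' Q' => positive_sliding_move P' Q' \/ snake_move P' Q') P Q ->
     related positive_sliding_move P Q).
Proof.
split; last exact: nonrigid_sliding_related.
by move=> S _ P1 P2 P3; apply: rigid_spines_boundary.
Qed.
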